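(* Let $(A,[\cdot,\cdot],\rho)$ be a Lie algebroid over $M$. The reduced space $R^0_{\mathrm{diff}}$ of $0$-differentials on $A$ is isomorphic to $\mathrm{H}^1(A,\mathbb{R})$, the degree $1$ Chevalley–Eilenberg cohomology of the Lie algebroid $A$.
   Context: The Schouten bracket on $\Gamma(\wedge^\bullet A)$ extends the bracket of $\Gamma(A)$ with $[u,f]=\rho(u)f$, $[X,Y]=-(-1)^{(|X|-1)(|Y|-1)}[Y,X]$, $[X,Y\wedge Z]=[X,Y]\wedge Z+(-1)^{(|X|-1)|Y|}Y\wedge[X,Z]$, with $|X|=p$ for $X\in\Gamma(\wedge^pA)$. A $k$-differential on $A$ is an $\mathbb{R}$-linear map $\delta:\Gamma(\wedge^\bullet A)\to\Gamma(\wedge^{\bullet+k-1}A)$ with $\delta(X\wedge Y)=\delta(X)\wedge Y+(-1)^{(k-1)|X|}X\wedge\delta(Y)$ and $\delta[X,Y]=[\delta(X),Y]+(-1)^{(k-1)(|X|-1)}[X,\delta(Y)]$. It is exact if it equals $[\tau,\,\cdot\,]$ for some $\tau\in\Gamma(\wedge^kA)$ (for $k=0$, $\tau\in C^\infty(M)$). $R^k_{\mathrm{diff}}$ is the space of $k$-differentials modulo exact ones. $\mathrm{H}^\bullet(A,\mathbb{R})$ is the cohomology of $\Gamma(\wedge^\bullet A^* )$ with the Lie algebroid differential $d_A$. *)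

(* Defs.v *)
From HB Require Import structures.
From mathcomp Require Import all_boot all_order all_algebra all_fingroup.
From mathcomp Require Import all_classical all_reals all_analysis.
From mathcomp Require Import ring.

Set Implicit Arguments.
Unset Strict Implicit.
Unset Printing Implicit Defensive.

Import Order.TTheory GRing.Theory Num.Theory.
Import numFieldNormedType.Exports.

Local Open Scope classical_set_scope.
Local Open Scope ring_scope.

(* Linear subspaces of possibly infinite-dimensional real vector spaces.      *)
(* MathComp's {vspace V} and vector.v only cover the finite-dimensional case. *)

Record subspace (R : realType) (V : lmodType R) := Subspace {
  subspace_pred :> V -> Prop;
  subspace0 : subspace_pred 0;
  subspaceP : forall (a : R) (u v : V), subspace_pred u -> subspace_pred v ->
    subspace_pred (a *: u + v) }.

Section SubspaceModules.
Context (R : realType) (V : lmodType R) (W : subspace V).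

Definition subspace_mem : {pred V} := fun v => `[< W v >].

Lemma subspace_mem_submod_closed : submod_closed subspace_mem.
Proof.
split; first exact/asboolP/subspace0.
by move=> a u v /asboolP Wu /asboolP Wv; apply/asboolP/subspaceP.
Qed.

HB.instance Definition _ := GRing.isSubmodClosed.Build R V subspace_mem
  subspace_mem_submod_closed.

Record sub_of := SubOf { sub_val : V; sub_valP : sub_val \in subspace_mem }.

HB.instance Definition _ := [isSub for sub_val].
HB.instance Definition _ := [Choice of sub_of by <:].
HB.instance Definition _ := [SubChoice_isSubLmodule of sub_of by <:].

Lemma sub_ofP (v : sub_of) : W (val v).
Proof. exact/asboolP/(valP v). Qed.

Definition mk_sub (v : V) (Wv : W v) : sub_of := SubOf (asboolT Wv).

Definition subspace_equiv (u v : V) : bool := `[< W (u - v) >].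

Lemma subspace_equiv_is_equiv : equiv_class_of subspace_equiv.
Proof.
split.
- by move=> u; apply/asboolP; rewrite subrr; exact: subspace0.
- move=> u v; apply/asboolP/asboolP => Wuv.
    by rewrite -opprB -scaleN1r -[_ *: _]addr0; apply: subspaceP => //;
      exact: subspace0.
  by rewrite -opprB -scaleN1r -[_ *: _]addr0; apply: subspaceP => //;
    exact: subspace0.
- move=> v u w /asboolP Wuv /asboolP Wvw; apply/asboolP.
  have -> : u - w = 1 *: (u - v) + (v - w) by rewrite scale1r addrA subrK.
  exact: subspaceP.
Qed.

Canonical subspace_equiv_equiv := EquivRelPack subspace_equiv_is_equiv.
Canonical subspace_equiv_direct := defaultEncModRel subspace_equiv.

Definition quot_of : Type := {eq_quot subspace_equiv}%qT.

HB.instance Definition _ : EqQuotient V subspace_equiv quot_of :=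
  EqQuotient.on quot_of.
HB.instance Definition _ := Choice.on quot_of.

Definition quot_proj (v : V) : quot_of := (\pi_quot_of v)%qT.
Definition quot_repr (q : quot_of) : V := generic_quotient.repr q.

Lemma quot_projP u v : quot_proj u = quot_proj v <-> W (u - v).
Proof.
rewrite /quot_proj; split.
  by move=> /eqP; rewrite eqmodE => /asboolP.
by move=> Wuv; apply/eqP; rewrite eqmodE; apply/asboolP.
Qed.

Lemma quot_projK (q : quot_of) : quot_proj (quot_repr q) = q.
Proof. exact: reprK. Qed.

Definition quot_add (p q : quot_of) := quot_proj (quot_repr p + quot_repr q).
Definition quot_opp (p : quot_of) := quot_proj (- quot_repr p).
Definition quot_scale (a : R) (p : quot_of) := quot_proj (a *: quot_repr p).

Lemma subspaceD u v : W u -> W v -> W (u + v).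
Proof. by move=> Wu Wv; rewrite -[u]scale1r; exact: subspaceP. Qed.

Lemma subspaceZ a u : W u -> W (a *: u).
Proof.
by move=> Wu; rewrite -[_ *: _]addr0; apply: subspaceP => //; exact: subspace0.
Qed.

Lemma repr_quot_proj v : W (quot_repr (quot_proj v) - v).
Proof. by apply/quot_projP; rewrite quot_projK. Qed.

Lemma quot_addE u v : quot_add (quot_proj u) (quot_proj v) = quot_proj (u + v).
Proof.
by apply/quot_projP; rewrite opprD addrACA; apply: subspaceD;
  exact: repr_quot_proj.
Qed.

Lemma quot_oppE u : quot_opp (quot_proj u) = quot_proj (- u).
Proof.
apply/quot_projP; rewrite -opprD -[- (_ + _)]scaleN1r; apply: subspaceZ.
exact: repr_quot_proj.
Qed.

Lemma quot_scaleE a u : quot_scale a (quot_proj u) = quot_proj (a *: u).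
Proof.
by apply/quot_projP; rewrite -scalerBr; apply: subspaceZ; exact: repr_quot_proj.
Qed.

Lemma quot_addA : associative quot_add.
Proof.
move=> p q s; rewrite -[p]quot_projK -[q]quot_projK -[s]quot_projK.
by rewrite !quot_addE addrA.
Qed.

Lemma quot_addC : commutative quot_add.
Proof. by move=> p q; rewrite /quot_add addrC. Qed.

Lemma quot_add0 : left_id (quot_proj 0) quot_add.
Proof. by move=> p; rewrite -[p]quot_projK quot_addE add0r. Qed.

Lemma quot_addN : left_inverse (quot_proj 0) quot_opp quot_add.
Proof. by move=> p; rewrite -[p]quot_projK quot_oppE quot_addE addNr. Qed.

HB.instance Definition _ := GRing.isZmodule.Build quot_of
  quot_addA quot_addC quot_add0 quot_addN.

Lemma quot_scaleA a b p : quot_scale a (quot_scale b p) = quot_scale (a * b) p.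
Proof. by rewrite -[p]quot_projK !quot_scaleE scalerA. Qed.

Lemma quot_scale1 : left_id 1 quot_scale.
Proof. by move=> p; rewrite -[p]quot_projK quot_scaleE scale1r. Qed.

Lemma quot_scaleDr : right_distributive quot_scale +%R.
Proof.
move=> a p q; rewrite -[p]quot_projK -[q]quot_projK.
by rewrite [_ + _]quot_addE !quot_scaleE scalerDr -quot_addE.
Qed.

Lemma quot_scaleDl p : {morph quot_scale^~ p : a b / a + b}.
Proof.
by move=> a b; rewrite -[p]quot_projK !quot_scaleE scalerDl -quot_addE.
Qed.

HB.instance Definition _ := GRing.Zmodule_isLmodule.Build R quot_of
  quot_scaleA quot_scale1 quot_scaleDr quot_scaleDl.

End SubspaceModules.

Definition dprod (R : realType) (I : Type) (V : I -> lmodType R) : Type :=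
  forall i, V i.

Section DependentProduct.
Context (R : realType) (I : Type) (V : I -> lmodType R).
Local Notation P := (dprod V).

HB.instance Definition _ := gen_eqMixin P.
HB.instance Definition _ := gen_choiceMixin P.

Definition dprod_add (f g : P) : P := fun i => f i + g i.
Definition dprod_opp (f : P) : P := fun i => - f i.
Definition dprod_zero : P := fun i => 0.
Definition dprod_scale (a : R) (f : P) : P := fun i => a *: f i.

Lemma dprod_addA : associative dprod_add.
Proof. by move=> f g h; apply: functional_extensionality_dep => i; exact: addrA. Qed.
Lemma dprod_addC : commutative dprod_add.
Proof. by move=> f g; apply: functional_extensionality_dep => i; exact: addrC. Qed.
Lemma dprod_add0 : left_id dprod_zero dprod_add.
Proof. by move=> f; apply: functional_extensionality_dep => i; exact: add0r. Qed.
Lemma dprod_addN : left_inverse dprod_zero dprod_opp dprod_add.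
Proof. by move=> f; apply: functional_extensionality_dep => i; exact: addNr. Qed.

HB.instance Definition _ := GRing.isZmodule.Build P
  dprod_addA dprod_addC dprod_add0 dprod_addN.

Lemma dprod_scaleA a b f : dprod_scale a (dprod_scale b f) = dprod_scale (a * b) f.
Proof. by apply: functional_extensionality_dep => i; exact: scalerA. Qed.
Lemma dprod_scale1 : left_id 1 dprod_scale.
Proof. by move=> f; apply: functional_extensionality_dep => i; exact: scale1r. Qed.
Lemma dprod_scaleDr : right_distributive dprod_scale +%R.
Proof. by move=> a f g; apply: functional_extensionality_dep => i; exact: scalerDr. Qed.
Lemma dprod_scaleDl f : {morph dprod_scale^~ f : a b / a + b}.
Proof. by move=> a b; apply: functional_extensionality_dep => i; exact: scalerDl. Qed.

HB.instance Definition _ := GRing.Zmodule_isLmodule.Build R P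
  dprod_scaleA dprod_scale1 dprod_scaleDr dprod_scaleDl.

End DependentProduct.

Section AlternatingForms.
Context (R : realType) (V : lmodType R).

Definition is_alternating (k : nat) (w : ('I_k -> V) -> R) : Prop :=
  (forall (i : 'I_k) (v : 'I_k -> V) (a : R) (x y : V),
     w (dfwith v i (a *: x + y)) = a * w (dfwith v i x) + w (dfwith v i y)) /\
  (forall (v : 'I_k -> V) (i j : 'I_k), i != j -> v i = v j -> w v = 0).

Lemma is_alternating0 k : @is_alternating k (0 : ('I_k -> V) -> R^o).
Proof. by split=> // *; rewrite mulr0 addr0. Qed.

Lemma is_alternatingP k (a : R) (w w' : ('I_k -> V) -> R^o) :
  is_alternating w -> is_alternating w' -> is_alternating (a *: w + w').
Proof.
move=> [wl wa] [w'l w'a]; split.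
  move=> i v b x y; rewrite -![(a *: w + w') _]/(a * w _ + w' _) wl w'l.
  by ring.
move=> v i j ij vij; rewrite -[(a *: w + w') _]/(a * w _ + w' _).
by rewrite (wa v i j) ?(w'a v i j)// mulr0 addr0.
Qed.

Definition alt_subspace k : subspace (('I_k -> V) -> R^o) :=
  Subspace (is_alternating0 k) (@is_alternatingP k).

(* alt k is the space of alternating k-linear forms on V, i.e. the k-th       *)
(* exterior power of the dual space of V when V is finite dimensional.        *)
Definition alt k : Type := sub_of (alt_subspace k).
HB.instance Definition _ k := GRing.Lmodule.on (alt k).

Definition alt_fun k (w : alt k) : ('I_k -> V) -> R := val w.

(* Inhomogeneous alternating forms. As alt k = 0 for k > dim V, this product  *)
(* over all degrees is also the direct sum.                                   *)
Definition forms : Type := dprod (fun k => alt k).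
HB.instance Definition _ := GRing.Lmodule.on forms.

Definition form_ev (X : forms) (k : nat) (v : 'I_k -> V) : R := alt_fun (X k) v.

End AlternatingForms.

Coercion alt_fun : alt >-> Funclass.

Lemma comb_sum (R : comNzRingType) (I : finType) (C F G H : I -> R) (a : R) :
  (forall i, F i = a * G i + H i) ->
  \sum_i C i * F i = a * (\sum_i C i * G i) + \sum_i C i * H i.
Proof.
move=> FE; rewrite mulr_sumr -big_split/=; apply: eq_bigr => i _.
by rewrite FE mulrDr mulrCA.
Qed.

Section Wedge.
Context (R : realType) (V : lmodType R).

(* The first p and the last k - p indices in {0, ..., k - 1}, for p <= k. *)
Definition lo_ix k (p : 'I_k.+1) (i : 'I_p) : 'I_k := widen_ord (leq_ord p) i.
Definition hi_ix k (p : 'I_k.+1) (j : 'I_(k - p)) : 'I_k :=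
  cast_ord (subnKC (leq_ord p)) (rshift p j).

(* (X /\ Y)(v_1, .., v_k) is the sum over p + q = k of                        *)
(*   1/(p! q!) \sum_s sgn(s) X(v_s(1), .., v_s(p)) Y(v_s(p+1), .., v_s(k)).   *)
Definition wedge_fun (X Y : forms V) (k : nat) (v : 'I_k -> V) : R :=
  \sum_(p < k.+1) (p`! * (k - p)`!)%:R^-1 *
    \sum_(s : 'S_k) (-1) ^+ s *
      (form_ev X (fun i => v (s (@lo_ix k p i))) *
       form_ev Y (fun j => v (s (@hi_ix k p j)))).

Lemma form_ev_lin X k (i : 'I_k) (v : 'I_k -> V) (a : R) (x y : V) :
  form_ev X (dfwith v i (a *: x + y)) =
  a * form_ev X (dfwith v i x) + form_ev X (dfwith v i y).
Proof. by have [+ _] := sub_ofP (X k); apply. Qed.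

Lemma form_ev_alt X k (v : 'I_k -> V) (i j : 'I_k) :
  i != j -> v i = v j -> form_ev X v = 0.
Proof. by have [_ +] := sub_ofP (X k); apply. Qed.

Lemma form_ev_sum X k (I : finType) (i : 'I_k) (v : 'I_k -> V) (c : I -> R)
    (e : I -> V) : form_ev X (dfwith v i (\sum_l c l *: e l)) =
  \sum_l c l * form_ev X (dfwith v i (e l)).
Proof.
elim: (index_enum I) => [|l s IH].
  rewrite !big_nil; have := form_ev_lin X i v (- 1) 0 0.
  by rewrite scaler0 addr0 mulN1r addNr.
by rewrite !big_cons form_ev_lin IH.
Qed.

Lemma lo_ix_inj k (p : 'I_k.+1) : injective (@lo_ix k p).
Proof. by move=> i j /(congr1 val)/= /val_inj. Qed.

Lemma hi_ix_inj k (p : 'I_k.+1) : injective (@hi_ix k p).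
Proof. by move=> i j /(congr1 val)/= /addnI /val_inj. Qed.

Lemma lo_hi_ix k (p : 'I_k.+1) i j : @lo_ix k p i != @hi_ix k p j.
Proof.
rewrite -val_eqE /= neq_ltn; apply/orP; left.
by rewrite (leq_trans (ltn_ord i))// leq_addr.
Qed.

Lemma ixP k (p : 'I_k.+1) (m : 'I_k) :
  (exists i, m = @lo_ix k p i) \/ (exists j, m = @hi_ix k p j).
Proof.
have [mp|pm] := ltnP m p.
  by left; exists (Ordinal mp); apply: val_inj.
have jP : (m - p < k - p)%N by rewrite ltn_sub2r// (leq_ltn_trans pm).
by right; exists (Ordinal jP); apply: val_inj; rewrite /= subnKC.
Qed.

Lemma dfwith_comp (I J : eqType) (T : Type) (f : J -> I) (v : I -> T) j x :
  injective f ->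
  (fun m => dfwith v (f j) x (f m) : T) = dfwith (fun m => v (f m)) j x.
Proof.
move=> finj; apply/funext => m.
have [->|jm] := eqVneq j m; first by rewrite !dfwithin.
by rewrite !dfwithout// (inj_eq finj).
Qed.

Lemma dfwith_comp_out (I J : eqType) (T : Type) (f : J -> I) (v : I -> T) i x :
  (forall j, i != f j) -> (fun m => dfwith v i x (f m) : T) = (fun m => v (f m)).
Proof. by move=> fi; apply/funext => m; rewrite dfwithout. Qed.

Lemma wedge_fun_alternating X Y k : is_alternating (@wedge_fun X Y k).
Proof.
split.
  move=> i v a x y; rewrite /wedge_fun.
  apply: comb_sum => p; apply: comb_sum => s.
  have {i} [i ->] : exists m, i = s m by exists (s^-1 i)%g; rewrite permKV.
  have s_inj (J : eqType) (f : J -> 'I_k) : injective f -> injective (s \o f).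
    by move=> fi; apply: inj_comp => //; exact: perm_inj.
  case: (ixP p i) => [] [j ->].
  - have E z := dfwith_comp v j z (s_inj _ _ (@lo_ix_inj k p)).
    have F z := @dfwith_comp_out _ _ _ (fun m => s (@hi_ix k p m)) v
      (s (lo_ix j)) z (fun m => contra_neq (@perm_inj _ s _ _) (lo_hi_ix j m)).
    by rewrite !F !E form_ev_lin mulrDl mulrA.
  - have E z := dfwith_comp v j z (s_inj _ _ (@hi_ix_inj k p)).
    have F z := @dfwith_comp_out _ _ _ (fun m => s (@lo_ix k p m)) v
      (s (hi_ix j)) z (fun m => contra_neq (fun e => esym (@perm_inj _ s _ _ e)) (lo_hi_ix m j)).
    by rewrite !F !E form_ev_lin mulrDr mulrCA.
move=> v i j ij vij; rewrite /wedge_fun big1// => p _.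
set S := \sum_(s : 'S_k) _; suff : S = - S.
  by move/eqP; rewrite -subr_eq0 opprK -mulr2n mulrn_eq0/= => /eqP->; rewrite mulr0.
rewrite {1}/S (reindex_inj (mulIg (tperm i j)))/= -sumrN; apply: eq_bigr => s _.
rewrite odd_permM odd_tperm ij signr_addb mulrN1 mulNr.
have vt m : v (tperm i j m) = v m by case: tpermP => // ->.
by congr (- (_ * (_ * _))); congr form_ev; apply/funext => m; rewrite permM vt.
Qed.

Definition wedge (X Y : forms V) : forms V :=
  fun k => mk_sub (W := alt_subspace V k) (@wedge_fun_alternating X Y k).

Lemma formsP (X Y : forms V) : (forall k (v : 'I_k -> V), form_ev X v = form_ev Y v) -> X = Y.
Proof.
move=> XY; apply: functional_extensionality_dep => k; apply: val_inj.
by apply/funext => v; exact: XY.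
Qed.

Lemma wedge_combl a X X' Y : wedge (a *: X + X') Y = a *: wedge X Y + wedge X' Y.
Proof.
apply: formsP => k v.
rewrite -[form_ev (_ + _) v]/(a * wedge_fun X Y v + wedge_fun X' Y v).
rewrite -[LHS]/(wedge_fun (a *: X + X') Y v) /wedge_fun.
apply: comb_sum => p; apply: comb_sum => s.
by rewrite -[form_ev (a *: X + X') _]/(a * form_ev X _ + form_ev X' _) mulrDl mulrA.
Qed.

Lemma wedge_combr a X Y Y' : wedge X (a *: Y + Y') = a *: wedge X Y + wedge X Y'.
Proof.
apply: formsP => k v.
rewrite -[form_ev (_ + _) v]/(a * wedge_fun X Y v + wedge_fun X Y' v).
rewrite -[LHS]/(wedge_fun X (a *: Y + Y') v) /wedge_fun.
apply: comb_sum => p; apply: comb_sum => s.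
rewrite -[form_ev (a *: Y + Y') _]/(a * form_ev Y _ + form_ev Y' _) mulrDr.
by rewrite mulrCA.
Qed.

(* A scalar c as a form of degree 0 and a linear form as a form of degree 1. *)
Definition form0_fun (c : R) (k : nat) : ('I_k -> V) -> R :=
  match k with 0 => fun _ => c | _ => fun _ => 0 end.

Definition form1_fun (l : {linear V -> R^o}) (k : nat) : ('I_k -> V) -> R :=
  match k with 1 => fun v => l (v ord0) | _ => fun _ => 0 end.

Lemma form0_alternating c k : is_alternating (@form0_fun c k).
Proof.
case: k => [|k]; split=> //=; first by case.
- by move=> v [].
- by move=> i v a x y; rewrite mulr0 addr0.
Qed.

Lemma form1_alternating l k : is_alternating (@form1_fun l k).
Proof.
case: k => [|[|k]]; split=> //=.
- by move=> *; rewrite mulr0 addr0.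
- by move=> i v a x y; rewrite (ord1 i) !dfwithin linearP.
- by move=> v i j; rewrite !ord1.
- by move=> *; rewrite mulr0 addr0.
Qed.

Definition form0 (c : R) : forms V :=
  fun k => mk_sub (W := alt_subspace V k) (form0_alternating c k).
Definition form1 (l : {linear V -> R^o}) : forms V :=
  fun k => mk_sub (W := alt_subspace V k) (form1_alternating l k).

End Wedge.

Section EuclideanSmoothness.
Context (R : realType) (n : nat).
Implicit Types (U : set 'rV[R]_n) (f g : 'rV[R]_n -> R^o).

(* f is of class C^k on the open set U: all partial derivatives of order at   *)
(* most k exist and are continuous on U.                                      *)
Fixpoint class_C (k : nat) U f : Prop :=
  match k with
  | 0 => forall x, U x -> {for x, continuous f}
  | k'.+1 => (forall x, U x -> {for x, continuous f}) /\
      forall i : 'I_n, (forall x, U x -> derivable f x (delta_mx 0 i)) /\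
        class_C k' U (fun x => 'D_(delta_mx 0 i) f x)
  end.

Definition smooth_on U f : Prop := forall k, class_C k U f.

Lemma class_C_cont k U f : class_C k U f -> forall x, U x -> {for x, continuous f}.
Proof. by case: k => [|k []]. Qed.

Lemma class_CS k U f : class_C k.+1 U f -> class_C k U f.
Proof.
elim: k f => [|k IH] f; first by case.
move=> [fc fd]; split=> // i; have [di Ci] := fd i.
by split=> //; exact: IH.
Qed.

Lemma class_C_local k U f :
  (forall x, U x -> exists2 W : set 'rV[R]_n, W x & class_C k W f) -> class_C k U f.
Proof.
elim: k f => [|k IH] f UW; first by move=> x /UW[W Wx]; exact.
split=> [x /UW[W Wx /class_C_cont]|i]; first exact.
split=> [x /UW[W Wx [_ /(_ i)[+ _]]]|]; first exact.
apply: IH => x /UW[W Wx [_ /(_ i)[_ CW]]]; by exists W.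
Qed.

Lemma class_C_sub k U U' f : U' `<=` U -> class_C k U f -> class_C k U' f.
Proof. by move=> sU Uf; apply: class_C_local => x /sU Ux; exists U. Qed.

Lemma class_C_ext k U f g : open U -> (forall x, U x -> f x = g x) ->
  class_C k U f -> class_C k U g.
Proof.
move=> oU.
have near_fg (f' g' : 'rV[R]_n -> R^o) x : U x -> (forall x, U x -> f' x = g' x) ->
    {near x, f' =1 g'}.
  by move=> Ux fg; apply: filterS (open_nbhs_nbhs (conj oU Ux)) => y /fg.
have cont (f' g' : 'rV[R]_n -> R^o) x : U x -> (forall x, U x -> f' x = g' x) ->
    {for x, continuous f'} -> {for x, continuous g'}.
  move=> Ux fg cf; rewrite /prop_for /continuous_at -fg//.
  by apply: cvg_trans cf; exact: (near_eq_cvg (near_fg _ _ _ Ux fg)).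
elim: k f g => [|k IH] f g fg.
  by move=> cf x Ux; apply: (cont f) => //; exact: cf.
move=> [cf df]; split=> [x Ux|i]; first by apply: (cont f) => //; exact: cf.
have [di Ci] := df i; split=> [x Ux|].
  exact: near_eq_derivable (near_fg _ _ _ Ux fg) (di x Ux).
apply: IH Ci => x Ux; exact: near_eq_derive (near_fg _ _ _ Ux fg).
Qed.

Lemma class_C_cst k U (c : R) : class_C k U (fun _ => c).
Proof.
elim: k c => [|k IH] c; first by move=> x _; exact: cst_continuous.
split=> [x _|i]; first exact: cst_continuous.
split=> [x _|]; first exact: derivable_cst.
rewrite (_ : (fun x => _) = (fun _ => (0 : R))); first exact: IH.
by apply/funext => x; rewrite derive_cst.
Qed.

Lemma class_CD k U f g : open U ->
  class_C k U f -> class_C k U g -> class_C k U (fun x => f x + g x).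
Proof.
move=> oU; elim: k f g => [|k IH] f g.
  by move=> fc gc x Ux; exact: continuousD (fc x Ux) (gc x Ux).
move=> [fc fd] [gc gd]; split=> [x Ux|i].
  exact: continuousD (fc x Ux) (gc x Ux).
have [fi fC] := fd i; have [gi gC] := gd i; split=> [x Ux|].
  exact: derivableD (fi x Ux) (gi x Ux).
apply: class_C_ext (IH _ _ fC gC) => // x Ux.
by rewrite -[RHS]/('D_(delta_mx 0 i) (f + g) x) deriveD//; [exact: fi|exact: gi].
Qed.

Lemma class_CM k U f g : open U ->
  class_C k U f -> class_C k U g -> class_C k U (fun x => f x * g x).
Proof.
move=> oU; elim: k f g => [|k IH] f g.
  by move=> fc gc x Ux; exact: continuousM (fc x Ux) (gc x Ux).
move=> Cf Cg; have [fc fd] := Cf; have [gc gd] := Cg; split=> [x Ux|i].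
  exact: continuousM (fc x Ux) (gc x Ux).
have [fi fC] := fd i; have [gi gC] := gd i; split=> [x Ux|].
  exact: derivableM (fi x Ux) (gi x Ux).
have C1 := IH _ _ (class_CS Cf) gC; have C2 := IH _ _ (class_CS Cg) fC.
apply: class_C_ext (class_CD oU C1 C2) => // x Ux.
by rewrite -[RHS]/('D_(delta_mx 0 i) (f * g) x) deriveM//; [exact: fi|exact: gi].
Qed.

End EuclideanSmoothness.

(* The functions chart i and chart_inv i are only meaningful on chart_dom i   *)
(* and on its image, respectively.                                            *)

Record manifold (R : realType) (n : nat) := Manifold {
  manifold_space :> topologicalType;
  manifold_hausdorff : hausdorff_space manifold_space;
  manifold_countable : @second_countable manifold_space;
  chart_ix : Type;
  chart_dom : chart_ix -> set manifold_space;
  chart : chart_ix -> manifold_space -> 'rV[R]_n;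
  chart_inv : chart_ix -> 'rV[R]_n -> manifold_space;
  chart_dom_open : forall i, open (chart_dom i);
  chart_dom_cover : forall x, exists i, chart_dom i x;
  chart_img_open : forall i, open (chart i @` chart_dom i);
  chartK : forall i x, chart_dom i x -> chart_inv i (chart i x) = x;
  chart_continuous : forall i x, chart_dom i x -> {for x, continuous (chart i)};
  chart_inv_continuous : forall i y, (chart i @` chart_dom i) y ->
    {for y, continuous (chart_inv i)};
  chart_transition : forall i j (l : 'I_n),
    smooth_on (chart i @` (chart_dom i `&` chart_dom j))
      (fun y => chart j (chart_inv i y) 0 l) }.

Section SmoothFunctions.
Context (R : realType) (n : nat) (M : manifold R n).
Implicit Types (W : set M) (f g : M -> R^o).

Definition smooth_fun_on W f : Prop := forall i : chart_ix M,
  smooth_on (chart i @` (chart_dom i `&` W)) (fun y => f (chart_inv i y)).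

Lemma chart_img_openI i W : open W -> open (chart i @` (chart_dom i `&` W)).
Proof.
move=> oW; rewrite openE => _ [x [ix Wx] <-]; rewrite /interior.
have ciy : (chart i @` chart_dom i) (chart i x) by exists x.
have n1 := open_nbhs_nbhs (conj (@chart_img_open _ _ M i) ciy).
have nW : nbhs (chart_inv i (chart i x)) W.
  by rewrite chartK//; exact: open_nbhs_nbhs.
have n2 := chart_inv_continuous ciy nW.
apply: filterS2 n1 n2 => _ [x' ix' <-]; rewrite /= chartK// => Wx'.
by exists x'.
Qed.

Lemma smooth_fun_local W f :
  (forall x, W x -> exists2 W' : set M, W' x & smooth_fun_on W' f) ->
  smooth_fun_on W f.
Proof.
move=> loc i k; apply: class_C_local => _ [x [ix Wx] <-].
have [W' W'x sm] := loc x Wx.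
by exists (chart i @` (chart_dom i `&` W')); [exists x|exact: sm].
Qed.

Lemma smooth_fun_sub W W' f : W' `<=` W -> smooth_fun_on W f -> smooth_fun_on W' f.
Proof. by move=> sW sf; apply: smooth_fun_local => x /sW Wx; exists W. Qed.

Lemma smooth_fun_ext W f g : open W -> (forall x, W x -> f x = g x) ->
  smooth_fun_on W f -> smooth_fun_on W g.
Proof.
move=> oW fg sf i k; apply: class_C_ext (sf i k); first exact: chart_img_openI.
by move=> _ [x [ix Wx] <-]; rewrite chartK// fg.
Qed.

Lemma smooth_fun_cst W (c : R) : smooth_fun_on W (fun _ => c).
Proof. by move=> i k; exact: class_C_cst. Qed.

Lemma smooth_funD W f g : open W -> smooth_fun_on W f -> smooth_fun_on W g ->
  smooth_fun_on W (fun x => f x + g x).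
Proof.
move=> oW sf sg i k.
by apply: class_CD (sf i k) (sg i k); exact: chart_img_openI.
Qed.

Lemma smooth_funM W f g : open W -> smooth_fun_on W f -> smooth_fun_on W g ->
  smooth_fun_on W (fun x => f x * g x).
Proof.
move=> oW sf sg i k.
by apply: class_CM (sf i k) (sg i k); exact: chart_img_openI.
Qed.

Lemma smooth_fun_sum (I : finType) W (F : I -> M -> R^o) : open W ->
  (forall i, smooth_fun_on W (F i)) -> smooth_fun_on W (fun x => \sum_i F i x).
Proof.
move=> oW sF; elim: (index_enum I) => [|i s IH].
  rewrite (_ : (fun x => _) = (fun _ => (0 : R))); first exact: smooth_fun_cst.
  by apply/funext => x; rewrite big_nil.
rewrite (_ : (fun x => _) = (fun x => F i x + \sum_(j <- s) F j x)).
  exact: smooth_funD.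
by apply/funext => x; rewrite big_cons.
Qed.

Lemma smooth_subspace0 : smooth_fun_on setT (0 : M -> R^o).
Proof. exact: smooth_fun_cst. Qed.

Lemma smooth_subspaceP (a : R) f g : smooth_fun_on setT f ->
  smooth_fun_on setT g -> smooth_fun_on setT (a *: f + g).
Proof.
move=> sf sg; apply: smooth_funD => //; first exact: openT.
by apply: smooth_funM => //; [exact: openT|exact: smooth_fun_cst].
Qed.

Definition smooth_subspace : subspace (M -> R^o) :=
  Subspace smooth_subspace0 smooth_subspaceP.

Definition Cinf : Type := sub_of smooth_subspace.
HB.instance Definition _ := GRing.Lmodule.on Cinf.

Definition Cinf_fun (f : Cinf) : M -> R := val f.

Lemma Cinf_mul_smooth (f g : Cinf) :
  smooth_fun_on setT (fun x => Cinf_fun f x * Cinf_fun g x).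
Proof. by apply: smooth_funM; [exact: openT|exact: (sub_ofP f)|exact: (sub_ofP g)]. Qed.

Definition Cinf_mul (f g : Cinf) : Cinf :=
  mk_sub (W := smooth_subspace) (Cinf_mul_smooth f g).

End SmoothFunctions.

Coercion Cinf_fun : Cinf >-> Funclass.

(* The tangent space at x is the space of derivations at x of the algebra of  *)
(* smooth functions.                                                          *)

Section TangentSpace.
Context (R : realType) (n : nat) (M : manifold R n) (x : M).

Definition is_derivation_at (D : Cinf M -> R^o) : Prop :=
  (forall (a : R) (f g : Cinf M), D (a *: f + g) = a * D f + D g) /\
  (forall f g : Cinf M, D (Cinf_mul f g) = f x * D g + g x * D f).

Lemma is_derivation_at0 : is_derivation_at 0.
Proof. by split=> *; rewrite -![(0 : Cinf M -> R^o) _]/(0 : R) !mulr0 addr0. Qed.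

Lemma is_derivation_atP (a : R) (D D' : Cinf M -> R^o) :
  is_derivation_at D -> is_derivation_at D' -> is_derivation_at (a *: D + D').
Proof.
move=> [Dl DM] [D'l D'M]; split=> [b f g|f g].
  by rewrite -![(a *: D + D') _]/(a * D _ + D' _) Dl D'l; ring.
by rewrite -![(a *: D + D') _]/(a * D _ + D' _) DM D'M; ring.
Qed.

Definition tangent_space : Type :=
  sub_of (Subspace is_derivation_at0 is_derivation_atP).
HB.instance Definition _ := GRing.Lmodule.on tangent_space.

Definition tangent_app (D : tangent_space) : Cinf M -> R := val D.

End TangentSpace.

Coercion tangent_app : tangent_space >-> Funclass.

(* The topology and smooth structure of the total space are encoded by the    *)
(* local trivializations and the smoothness of their transition functions.    *)

Record vector_bundle (R : realType) (n : nat) (M : manifold R n) (r : nat) :=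
    VectorBundle {
  fiber :> M -> vectType R;
  triv_ix : Type;
  triv_dom : triv_ix -> set M;
  triv : forall (a : triv_ix) (x : M), 'Hom(fiber x, 'rV[R]_r);
  triv_dom_open : forall a, open (triv_dom a);
  triv_dom_cover : forall x, exists a, triv_dom a x;
  triv_bij : forall a x, triv_dom a x -> bijective (triv a x);
  triv_transition : forall a b (i j : 'I_r),
    smooth_fun_on (triv_dom a `&` triv_dom b)
      (fun x => triv b x ((triv a x)^-1%VF (delta_mx 0 i)) 0 j) }.

Section Sections.
Context (R : realType) (n : nat) (M : manifold R n) (r : nat).
Context (E : vector_bundle M r).

Definition frame (a : triv_ix E) (x : M) (i : 'I_r) : E x :=
  ((triv a x)^-1)%VF (delta_mx 0 i).

Lemma trivK a x : triv_dom a x -> cancel (@triv _ _ _ _ E a x) (triv a x)^-1%VF.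
Proof.
move=> ax; apply: lker0_lfunK; apply/lker0P; exact: bij_inj (triv_bij ax).
Qed.

Lemma triv_invK a x : triv_dom a x -> cancel (triv a x)^-1%VF (@triv _ _ _ _ E a x).
Proof.
move=> ax v; have [g gK Kg] := triv_bij ax.
by rewrite -[v]Kg trivK.
Qed.

Lemma frame_expand a x (u : E x) : triv_dom a x ->
  u = \sum_i (triv a x u) 0 i *: frame a x i.
Proof.
move=> ax; rewrite -{1}(trivK ax u) {1}[triv a x u]row_sum_delta linear_sum/=.
by apply: eq_bigr => i _; rewrite linearZ.
Qed.

Definition is_smooth_section (s : dprod (fun x : M => E x : lmodType R)) : Prop :=
  forall (a : triv_ix E) (j : 'I_r),
    smooth_fun_on (triv_dom a) (fun x => triv a x (s x) 0 j).

Lemma is_smooth_section0 : is_smooth_section 0.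
Proof.
move=> a j; rewrite (_ : (fun x => _) = (fun _ => (0 : R))).
  exact: smooth_fun_cst.
by apply/funext => x; rewrite [(0 : dprod _) x](_ : _ = 0)// linear0 mxE.
Qed.

Lemma is_smooth_sectionP c s t : is_smooth_section s -> is_smooth_section t ->
  is_smooth_section (c *: s + t).
Proof.
move=> ss st a j; have oa := triv_dom_open a.
rewrite (_ : (fun x => _) =
    (fun x => c * triv a x (s x) 0 j + triv a x (t x) 0 j)).
  apply: smooth_funD => //; apply: smooth_funM => //; exact: smooth_fun_cst.
apply/funext => x; rewrite [(c *: s + t) x](_ : _ = c *: s x + t x)//.
by rewrite linearP !mxE.
Qed.

Definition section_subspace : subspace (dprod (fun x : M => E x : lmodType R)) :=
  Subspace is_smooth_section0 is_smooth_sectionP.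

Definition sections : Type := sub_of section_subspace.
HB.instance Definition _ := GRing.Lmodule.on sections.

Definition section_at (s : sections) : forall x : M, E x := val s.

Lemma section_mul_smooth (f : Cinf M) (s : sections) :
  is_smooth_section (fun x => f x *: section_at s x).
Proof.
move=> a j; have oa := triv_dom_open a.
rewrite (_ : (fun x => _) = (fun x => f x * triv a x (section_at s x) 0 j)).
  apply: smooth_funM => //; last exact: (sub_ofP s).
  by apply: smooth_fun_sub (sub_ofP f) => x.
by apply/funext => x; rewrite linearZ mxE.
Qed.

Definition section_mul (f : Cinf M) (s : sections) : sections :=
  mk_sub (W := section_subspace) (section_mul_smooth f s).

(* Smooth sections of the exterior algebra bundle of the dual of E, i.e.      *)
(* fields of alternating forms on the fibers of E with smooth components in   *)
(* the local frames.                                                          *)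
Definition is_smooth_form (w : dprod (fun x : M => forms (E x))) : Prop :=
  forall (a : triv_ix E) (k : nat) (I : 'I_k -> 'I_r),
    smooth_fun_on (triv_dom a) (fun x => form_ev (w x) (fun j => frame a x (I j))).

Lemma is_smooth_form0 : is_smooth_form 0.
Proof. by move=> a k I; exact: smooth_fun_cst. Qed.

Lemma is_smooth_formP c w w' : is_smooth_form w -> is_smooth_form w' ->
  is_smooth_form (c *: w + w').
Proof.
move=> sw sw' a k I; have oa := triv_dom_open a.
apply: smooth_funD => //; last exact: sw'.
apply: smooth_funM => //; first exact: smooth_fun_cst.
exact: sw.
Qed.

Definition form_subspace : subspace (dprod (fun x : M => forms (E x))) :=
  Subspace is_smooth_form0 is_smooth_formP.

Definition form_sections : Type := sub_of form_subspace.
HB.instance Definition _ := GRing.Lmodule.on form_sections.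

Definition form_at (w : form_sections) (x : M) : forms (E x) := val w x.

Lemma form_sectionsP (w w' : form_sections) :
  (forall x k (v : 'I_k -> E x), form_ev (form_at w x) v = form_ev (form_at w' x) v) ->
  w = w'.
Proof.
move=> ww'; apply: val_inj; apply: functional_extensionality_dep => x.
by apply: formsP => k v; exact: ww'.
Qed.

(* w is homogeneous of degree d; for d < 0 this means w = 0. *)
Definition homogeneous (d : int) (w : form_sections) : Prop :=
  forall (k : nat) (x : M) (v : 'I_k -> E x), k%:Z != d -> form_ev (form_at w x) v = 0.

Lemma homogeneous0 d : homogeneous d 0.
Proof. by []. Qed.

Lemma homogeneousP d (c : R) w w' : homogeneous d w -> homogeneous d w' ->
  homogeneous d (c *: w + w').
Proof.
move=> hw hw' k x v kd.
rewrite -[LHS]/(c * form_ev (form_at w x) v + form_ev (form_at w' x) v).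
by rewrite hw// hw'// mulr0 addr0.
Qed.

Lemma form_wedge_smooth (w w' : form_sections) :
  is_smooth_form (fun x => wedge (form_at w x) (form_at w' x)).
Proof.
move=> a k I; have oa := triv_dom_open a.
apply: smooth_fun_sum => // p; apply: smooth_funM => //.
  exact: smooth_fun_cst.
apply: smooth_fun_sum => // s; apply: smooth_funM => //.
  exact: smooth_fun_cst.
by apply: smooth_funM => //; [exact: (sub_ofP w)|exact: (sub_ofP w')].
Qed.

Definition form_wedge (w w' : form_sections) : form_sections :=
  mk_sub (W := form_subspace) (form_wedge_smooth w w').

Lemma form_wedge_combl c w w' z :
  form_wedge (c *: w + w') z = c *: form_wedge w z + form_wedge w' z.
Proof.
apply: val_inj; apply: functional_extensionality_dep => x; exact: wedge_combl.
Qed.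

Lemma form_wedge_combr c w z z' :
  form_wedge w (c *: z + z') = c *: form_wedge w z + form_wedge w z'.
Proof.
apply: val_inj; apply: functional_extensionality_dep => x; exact: wedge_combr.
Qed.

Lemma form_fun_smooth (f : Cinf M) : is_smooth_form (fun x => form0 (E x) (f x)).
Proof.
move=> a [|k] I; last exact: smooth_fun_cst.
by apply: smooth_fun_sub (sub_ofP f) => x.
Qed.

Definition form_fun (f : Cinf M) : form_sections := mk_sub (W := form_subspace) (form_fun_smooth f).

Lemma form_eval_smooth (w : form_sections) (k : nat) (u : 'I_k -> sections) :
  smooth_fun_on setT (fun x => form_ev (form_at w x) (fun j => section_at (u j) x)).
Proof.
apply: smooth_fun_local => x _; have [a ax] := triv_dom_cover E x.
exists (triv_dom a) => //; have oa := triv_dom_open a.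
suff H m : (m <= k)%N -> forall v : (forall y, 'I_k -> E y),
    (forall j : 'I_k, (j < m)%N -> forall l : 'I_r,
       smooth_fun_on (triv_dom a) (fun y => triv a y (v y j) 0 l)) ->
    (forall j : 'I_k, (m <= j)%N -> exists l, forall y, v y j = frame a y l) ->
    smooth_fun_on (triv_dom a) (fun y => form_ev (form_at w y) (v y)).
  apply: (H k (leqnn k) (fun y j => section_at (u j) y)) => [j _ l|j].
    exact: (sub_ofP (u j)).
  by rewrite leqNgt ltn_ord.
elim: m => [|m IH] mk v vs vf.
  have [I vI] := choice (fun j => vf j (leq0n j)).
  rewrite (_ : (fun y => _) =
      (fun y => form_ev (form_at w y) (fun j => frame a y (I j)))).
    exact: (sub_ofP w).
  by apply/funext => y; congr form_ev; apply/funext => j; exact: vI.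
pose i := Ordinal mk.
pose F l y := triv a y (v y i) 0 l *
  form_ev (form_at w y) (dfwith (v y) i (frame a y l)).
apply: (@smooth_fun_ext _ _ _ _ (fun y => \sum_l F l y)) => // [y ay|].
  rewrite /F -form_ev_sum -frame_expand//; congr form_ev.
  by apply/funext => j; case: dfwithP.
apply: smooth_fun_sum => // l; apply: smooth_funM => //; first exact: vs.
apply: IH => [|j jm l'|j mj]; first exact: ltnW.
  have ij : i != j by rewrite -val_eqE/= gtn_eqF.
  rewrite (_ : (fun y => _) = (fun y => triv a y (v y j) 0 l')).
    exact/vs/ltnW.
  by apply/funext => y; rewrite dfwithout.
have [->|ij] := eqVneq j i; first by exists l => y; rewrite dfwithin.
have [|l' vl'] := vf j; first by rewrite ltn_neqAle mj andbT eq_sym -val_eqE in ij *.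
by exists l' => y; rewrite dfwithout// eq_sym.
Qed.

Definition form_eval (w : form_sections) (k : nat) (u : 'I_k -> sections) : Cinf M :=
  mk_sub (W := smooth_subspace M) (form_eval_smooth w u).

End Sections.

Section DualBundle.
Context (R : realType) (n : nat) (M : manifold R n) (r : nat).
Context (A : vector_bundle M r).

Definition dual_fiber (x : M) : vectType R := 'Hom(A x, R^o).

Definition dual_coord (a : triv_ix A) (x : M) (xi : dual_fiber x) : 'rV[R]_r :=
  \row_i (xi : 'Hom(A x, R^o)) (frame a x i).

Lemma dual_coord_is_linear a x : linear (@dual_coord a x).
Proof. by move=> c xi xi'; apply/rowP => i; rewrite !mxE add_lfunE scale_lfunE. Qed.

HB.instance Definition _ a x := GRing.isLinear.Build R (dual_fiber x) 'rV[R]_r _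
  (@dual_coord a x) (@dual_coord_is_linear a x).

Definition dual_triv (a : triv_ix A) (x : M) : 'Hom(dual_fiber x, 'rV[R]_r) :=
  linfun (@dual_coord a x).

Definition dual_comb (a : triv_ix A) (x : M) (c : 'rV[R]_r) (u : A x) : R^o :=
  \sum_i c 0 i * (triv a x u) 0 i.

Lemma dual_comb_is_linear a x c : linear (@dual_comb a x c).
Proof.
move=> b u v; rewrite /dual_comb linearP.
rewrite -[RHS]/(b * _ + _) mulr_sumr -big_split/=; apply: eq_bigr => i _.
by rewrite !mxE mulrDr mulrCA.
Qed.

HB.instance Definition _ a x c := GRing.isLinear.Build R (A x) R^o _
  (@dual_comb a x c) (@dual_comb_is_linear a x c).

Lemma triv_frame (a : triv_ix A) x i j : triv_dom a x -> triv a x (frame a x i) 0 j = (i == j)%:R.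
Proof. by move=> ax; rewrite /frame triv_invK// mxE eqxx/= eq_sym. Qed.

Lemma dual_combK (a : triv_ix A) x : triv_dom a x ->
  cancel (fun c => linfun (@dual_comb a x c) : dual_fiber x) (dual_triv a x).
Proof.
move=> ax c; rewrite lfunE; apply/rowP => i; rewrite mxE lfunE/= /dual_comb.
rewrite (bigD1 i)//= triv_frame// eqxx mulr1 big1 ?addr0// => j ji.
by rewrite triv_frame// eq_sym (negPf ji) mulr0.
Qed.

Lemma dual_trivK (a : triv_ix A) x : triv_dom a x ->
  cancel (dual_triv a x) (fun c => linfun (@dual_comb a x c) : dual_fiber x).
Proof.
move=> ax xi; apply/lfunP => u; rewrite lfunE/= /dual_comb.
rewrite [in RHS](frame_expand u ax) linear_sum; apply: eq_bigr => i _.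
by rewrite linearZ lfunE mxE mulrC.
Qed.

Lemma dual_triv_bij (a : triv_ix A) x : triv_dom a x -> bijective (dual_triv a x).
Proof.
move=> ax; exists (fun c => linfun (@dual_comb a x c) : dual_fiber x).
  exact: dual_trivK.
exact: dual_combK.
Qed.

Lemma dual_frameE (a : triv_ix A) x i (u : A x) : triv_dom a x ->
  (((dual_triv a x)^-1)%VF (delta_mx 0 i) : 'Hom(A x, R^o)) u = triv a x u 0 i.
Proof.
move=> ax; have := dual_combK ax (delta_mx 0 i).
set xi := (X in dual_triv a x X = _) => <-.
rewrite lker0_lfunK; last by apply/lker0P; exact: bij_inj (dual_triv_bij ax).
rewrite /xi lfunE/= /dual_comb (bigD1 i)//= mxE !eqxx mul1r big1 ?addr0// => j ji.
by rewrite mxE (negPf ji) andbF mul0r.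
Qed.

Lemma dual_transition (a b : triv_ix A) (i j : 'I_r) :
  smooth_fun_on (triv_dom a `&` triv_dom b)
    (fun x => dual_triv b x (((dual_triv a x)^-1)%VF (delta_mx 0 i)) 0 j).
Proof.
apply: (@smooth_fun_ext _ _ _ _ (fun x => triv a x (frame b x j) 0 i)).
- by apply: openI; exact: triv_dom_open.
- by move=> x [ax bx]; rewrite lfunE mxE dual_frameE.
- by rewrite setIC; exact: triv_transition.
Qed.

Definition dual_bundle : vector_bundle M r :=
  VectorBundle (@triv_dom_open _ _ _ _ A) (@triv_dom_cover _ _ _ _ A)
    dual_triv_bij dual_transition.

(* Sections of the exterior algebra bundle of A, where the k-th exterior      *)
(* power of a fiber V is realised as the alternating k-forms on its dual.     *)
Definition multivectors : Type := form_sections dual_bundle.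
HB.instance Definition _ := GRing.Lmodule.on multivectors.

Definition ev_at (x : M) (u : A x) (xi : dual_fiber x) : R^o :=
  (xi : 'Hom(A x, R^o)) u.

Lemma ev_at_is_linear x u : linear (@ev_at x u).
Proof. by move=> c xi xi'; rewrite /ev_at add_lfunE scale_lfunE. Qed.

HB.instance Definition _ x u := GRing.isLinear.Build R (dual_fiber x) R^o _
  (@ev_at x u) (@ev_at_is_linear x u).

Lemma mv_section_smooth (u : sections A) : is_smooth_form (E := dual_bundle)
  (fun x => form1 (V := dual_fiber x) (@ev_at x (section_at u x))).
Proof.
move=> a [|[|k]] I; try exact: smooth_fun_cst.
apply: smooth_fun_ext (sub_ofP u a (I ord0)); first exact: triv_dom_open.
by move=> x ax; rewrite -[RHS]/((_ : 'Hom(A x, R^o)) (section_at u x)) dual_frameE.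
Qed.

Definition mv_section (u : sections A) : multivectors :=
  mk_sub (W := form_subspace dual_bundle) (mv_section_smooth u).

Definition mv_fun (f : Cinf M) : multivectors := form_fun dual_bundle f.

End DualBundle.

(* The anchor is a smooth bundle map to the tangent bundle: smoothness of the *)
(* vector field rho(u) is tested on smooth functions. That rho preserves      *)
(* brackets follows from the Jacobi and Leibniz identities.                   *)
Record lie_algebroid (R : realType) (n : nat) (M : manifold R n) (r : nat)
    (A : vector_bundle M r) := LieAlgebroid {
  anchor : forall x : M, {linear A x -> tangent_space x};
  anchor_smooth : forall (u : sections A) (f : Cinf M),
    smooth_fun_on setT (fun x => tangent_app (anchor x (section_at u x)) f);
  bracket : sections A -> sections A -> sections A;
  bracket_linear : forall (a : R) (u v w : sections A),
    bracket (a *: u + v) w = a *: bracket u w + bracket v w;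
  bracket_alternating : forall u : sections A, bracket u u = 0;
  bracket_jacobi : forall u v w : sections A,
    bracket u (bracket v w) + bracket v (bracket w u) + bracket w (bracket u v) = 0;
  bracket_leibniz : forall (u v : sections A) (f : Cinf M),
    bracket u (section_mul f v) =
      section_mul f (bracket u v) +
      section_mul (mk_sub (W := smooth_subspace M) (anchor_smooth u f)) v }.

Section LieAlgebroid.
Context (R : realType) (n : nat) (M : manifold R n) (r : nat).
Context (A : vector_bundle M r) (L : lie_algebroid A).

Definition anchor_act (u : sections A) (f : Cinf M) : Cinf M :=
  mk_sub (W := smooth_subspace M) (anchor_smooth L u f).

(* The Schouten bracket. These conditions determine it uniquely.              *)
Record schouten_bracket := SchoutenBracket {
  schouten :> multivectors A -> multivectors A -> multivectors A;
  schouten_linearl : forall (a : R) (X Y Z : multivectors A),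
    schouten (a *: X + Y) Z = a *: schouten X Z + schouten Y Z;
  schouten_linearr : forall (a : R) (X Y Z : multivectors A),
    schouten Z (a *: X + Y) = a *: schouten Z X + schouten Z Y;
  schouten_degree : forall (p q : nat) (X Y : multivectors A),
    homogeneous p%:Z X -> homogeneous q%:Z Y ->
    homogeneous (p%:Z + q%:Z - 1) (schouten X Y);
  schouten_section : forall u v : sections A,
    schouten (mv_section u) (mv_section v) = mv_section (bracket L u v);
  schouten_fun : forall (u : sections A) (f : Cinf M),
    schouten (mv_section u) (mv_fun A f) = mv_fun A (anchor_act u f);
  schouten_antisym : forall (p q : nat) (X Y : multivectors A),
    homogeneous p%:Z X -> homogeneous q%:Z Y ->
    schouten X Y = - (-1) ^ ((p%:Z - 1) * (q%:Z - 1)) *: schouten Y X;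
  schouten_leibniz : forall (p q : nat) (X Y Z : multivectors A),
    homogeneous p%:Z X -> homogeneous q%:Z Y ->
    schouten X (form_wedge Y Z) =
      form_wedge (schouten X Y) Z +
      (-1) ^ ((p%:Z - 1) * q%:Z) *: form_wedge Y (schouten X Z) }.

Section Differentials.
Variables (S : schouten_bracket) (k : nat).
Implicit Types (d : multivectors A -> multivectors A) (X Y : multivectors A).

Definition is_differential d : Prop :=
  [/\ forall (a : R) X Y, d (a *: X + Y) = a *: d X + d Y,
      forall (p : nat) X, homogeneous p%:Z X -> homogeneous (p%:Z + k%:Z - 1) (d X),
      forall (p : nat) X Y, homogeneous p%:Z X ->
        d (form_wedge X Y) =
          form_wedge (d X) Y + (-1) ^ ((k%:Z - 1) * p%:Z) *: form_wedge X (d Y)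
    & forall (p : nat) X Y, homogeneous p%:Z X ->
        d (S X Y) = S (d X) Y + (-1) ^ ((k%:Z - 1) * (p%:Z - 1)) *: S X (d Y)].

Lemma comb_shuffle (V : lmodType R) (a b : R) (x y x' y' : V) :
  a *: (x + b *: y) + (x' + b *: y') = (a *: x + x') + b *: (a *: y + y').
Proof. by rewrite !scalerDr !scalerA [b * a]mulrC addrACA. Qed.

Lemma comb0 (V V' : lmodType R) (f : V -> V') :
  (forall (a : R) u v, f (a *: u + v) = a *: f u + f v) -> f 0 = 0.
Proof. by move=> /(_ (-1) 0 0); rewrite scaler0 addr0 scaleN1r addNr. Qed.

Lemma is_differential0 : is_differential 0.
Proof.
have w0l Y := comb0 (fun a X X' => form_wedge_combl a X X' Y).
have w0r Y := comb0 (fun a X X' => form_wedge_combr a Y X X').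
have s0l Y := comb0 (fun a X X' => schouten_linearl S a X X' Y).
have s0r Y := comb0 (fun a X X' => schouten_linearr S a X X' Y).
split=> [a X Y|p X _|p X Y _|p X Y _].
- by rewrite -[RHS]/(a *: 0 + 0 : multivectors A) scaler0 addr0.
- exact: homogeneous0.
- by rewrite w0l w0r scaler0 addr0.
- by rewrite s0l s0r scaler0 addr0.
Qed.

Lemma is_differentialP (a : R) d d' : is_differential d -> is_differential d' ->
  is_differential (a *: d + d').
Proof.
have E X : (a *: d + d') X = a *: d X + d' X by [].
move=> [dl dd dw ds] [d'l d'd d'w d's]; split=> [b X Y|p X hX|p X Y hX|p X Y hX].
- rewrite !E dl d'l [b *: (_ + _)]scalerDr !scalerDr !scalerA [b * a]mulrC.
  by rewrite addrACA.
- by rewrite E; apply: homogeneousP; [exact: dd|exact: d'd].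
- by rewrite !E (dw p)// (d'w p)// form_wedge_combl form_wedge_combr comb_shuffle.
- by rewrite !E (ds p)// (d's p)// schouten_linearl schouten_linearr comb_shuffle.
Qed.

Definition differential_subspace : subspace (multivectors A -> multivectors A) :=
  Subspace is_differential0 is_differentialP.

Definition differential : Type := sub_of differential_subspace.
HB.instance Definition _ := GRing.Lmodule.on differential.

(* By homogeneity tau is a smooth function when k = 0.                        *)
Definition is_exact_differential (d : differential) : Prop :=
  exists2 tau : multivectors A, homogeneous k%:Z tau & forall X, val d X = S tau X.

Lemma is_exact_differential0 : is_exact_differential 0.
Proof.
exists 0; first exact: homogeneous0.
move=> X; rewrite -[LHS]/(0 : multivectors A).
by rewrite (comb0 (fun a X' X'' => schouten_linearl S a X' X'' X)).
Qed.

Lemma is_exact_differentialP (a : R) (d d' : differential) :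
  is_exact_differential d -> is_exact_differential d' ->
  is_exact_differential (a *: d + d').
Proof.
move=> [t ht dt] [t' ht' dt']; exists (a *: t + t'); first exact: homogeneousP.
move=> X; rewrite schouten_linearl -dt -dt'; by [].
Qed.

Definition reduced_differentials : Type :=
  quot_of (Subspace is_exact_differential0 is_exact_differentialP).
HB.instance Definition _ := GRing.Lmodule.on reduced_differentials.

End Differentials.

Section Cohomology.
Implicit Types (w eta : form_sections A).

(* The value (d_A w)(u_0, .., u_k) of the Lie algebroid differential on a     *)
(* k-form w is the sum of                                                     *)
(*   \sum_i (-1)^i rho(u_i) w(.., u_i omitted, ..)                            *)
(*   \sum_(i < j) (-1)^(i + j) w([u_i, u_j], .., u_i, u_j omitted, ..);       *)
(* in the latter sum the bracket is moved to position i, which accounts for a *)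
(* factor (-1)^i.                                                             *)
Definition ce_value w (k : nat) (u : 'I_k.+1 -> sections A) : Cinf M :=
  \sum_(i < k.+1)
    (-1) ^+ i *: anchor_act (u i) (form_eval w (fun m : 'I_k => u (lift i m))) +
  \sum_(i < k.+1) \sum_(j < k.+1 | (i < j)%N)
    (-1) ^+ j *: form_eval w (fun m : 'I_k =>
      dfwith u i (bracket L (u i) (u j)) (lift j m)).

(* eta = d_A w. This is stated as a relation, so as not to have to extend     *)
(* vectors to sections and show that the formula above is pointwise.          *)
Definition is_ce_differential w eta : Prop :=
  (forall u : 'I_0 -> sections A, form_eval eta u = 0) /\
  (forall (k : nat) (u : 'I_k.+1 -> sections A), form_eval eta u = ce_value w u).

Lemma CinfP (f g : Cinf M) : (forall x, f x = g x) -> f = g.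
Proof. by move=> fg; apply: val_inj; apply/funext. Qed.

Lemma form_evalP (a : R) w w' k (u : 'I_k -> sections A) :
  form_eval (a *: w + w') u = a *: form_eval w u + form_eval w' u.
Proof. exact: CinfP. Qed.

Lemma anchor_actP (a : R) (u : sections A) (f g : Cinf M) :
  anchor_act u (a *: f + g) = a *: anchor_act u f + anchor_act u g.
Proof.
by apply: CinfP => x; have [+ _] := sub_ofP (anchor L x (section_at u x)); apply.
Qed.

Lemma ce_valueP (a : R) w w' k (u : 'I_k.+1 -> sections A) :
  ce_value (a *: w + w') u = a *: ce_value w u + ce_value w' u.
Proof.
rewrite /ce_value scalerDr addrACA; congr (_ + _).
  rewrite scaler_sumr -big_split/=; apply: eq_bigr => i _.
  by rewrite form_evalP anchor_actP scalerDr !scalerA [_ * a]mulrC.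
rewrite scaler_sumr -big_split/=; apply: eq_bigr => i _.
rewrite scaler_sumr -big_split/=; apply: eq_bigr => j _.
by rewrite form_evalP scalerDr !scalerA [_ * a]mulrC.
Qed.

Lemma is_ce_differentialP (a : R) w w' eta eta' :
  is_ce_differential w eta -> is_ce_differential w' eta' ->
  is_ce_differential (a *: w + w') (a *: eta + eta').
Proof.
move=> [e0 eS] [e0' eS']; split=> [u|k u].
  by rewrite form_evalP e0 e0' scaler0 addr0.
by rewrite form_evalP eS eS' ce_valueP.
Qed.

Lemma is_ce_differential0 : is_ce_differential 0 0.
Proof.
have z k (u : 'I_k -> sections A) : form_eval (0 : form_sections A) u = 0.
  exact: CinfP.
split=> [u|k u]; first exact: z.
have := ce_valueP (-1) 0 0 u.
by rewrite scaler0 addr0 scaleN1r addNr => ->; rewrite z.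
Qed.

Variable k : nat.

Definition is_cocycle w : Prop := homogeneous k%:Z w /\ is_ce_differential w 0.

Lemma is_cocycle0 : is_cocycle 0.
Proof. by split; [exact: homogeneous0|exact: is_ce_differential0]. Qed.

Lemma is_cocycleP (a : R) w w' : is_cocycle w -> is_cocycle w' ->
  is_cocycle (a *: w + w').
Proof.
move=> [hw dw] [hw' dw']; split; first exact: homogeneousP.
by have := is_ce_differentialP a dw dw'; rewrite scaler0 addr0.
Qed.

Definition cocycle : Type := sub_of (Subspace is_cocycle0 is_cocycleP).
HB.instance Definition _ := GRing.Lmodule.on cocycle.

(* For k = 0 the homogeneity condition forces theta = 0. *)
Definition is_coboundary (w : cocycle) : Prop :=
  exists2 theta : form_sections A,
    homogeneous (k%:Z - 1) theta & is_ce_differential theta (val w).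

Lemma is_coboundary0 : is_coboundary 0.
Proof. by exists 0; [exact: homogeneous0|exact: is_ce_differential0]. Qed.

Lemma is_coboundaryP (a : R) (w w' : cocycle) :
  is_coboundary w -> is_coboundary w' -> is_coboundary (a *: w + w').
Proof.
move=> [t ht dt] [t' ht' dt']; exists (a *: t + t'); first exact: homogeneousP.
exact: (is_ce_differentialP a dt dt').
Qed.

Definition lie_algebroid_cohomology : Type :=
  quot_of (Subspace is_coboundary0 is_coboundaryP).
HB.instance Definition _ := GRing.Lmodule.on lie_algebroid_cohomology.

End Cohomology.
End LieAlgebroid.

(* Main.v *)
From HB Require Import structures.
From mathcomp Require Import all_boot all_order all_algebra perm.
From mathcomp Require Import all_classical all_reals all_analysis.
From mathcomp Require Import ring lra.
Require Import Defs.

Set Implicit Arguments.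
Unset Strict Implicit.
Unset Printing Implicit Defensive.

Import Order.TTheory GRing.Theory Num.Theory.
Import numFieldNormedType.Exports.

Local Open Scope classical_set_scope.
Local Open Scope ring_scope.

(** A 0-differential d has degree -1 for the wedge product, so it kills functions,
is linear over the smooth functions on sections of A, and takes sections to
functions. It is therefore a 1-form w on A, and on general multivectors it must be
contraction with w. Applied to the bracket of two sections, compatibility with the
Schouten bracket says
  w([u, v]) = rho(u) w(v) - rho(v) w(u),
which is the equation d_A w = 0; and [f, u] = - rho(u) f shows that the exact
differentials are those with w = - d_A f. Thus d |-> w induces the isomorphism,
once it is known that every closed 1-form arises in this way and that a
0-differential is determined by its values on sections.

Both facts rest on one principle, derivation_eq0: a graded derivation of the
algebra of multivectors that vanishes on functions and on sections is zero. It
follows from an Euler identity. If b is a smooth function supported in the domain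
of a trivialization, e_i the local frame multiplied by b and eps_i the dual frame
multiplied by b, then the sum over i of e_i /\ (eps_i -| X) is (k + 1) b^2 X for X
of degree k + 1 (cutoff_euler). An induction on the degree therefore shows that the
derivation vanishes wherever b does not, and every point has such a b
(exists_cutoff), built from exp(-1/t).

That contraction with a closed w is a differential is the vanishing of the
defect of its compatibility with the bracket. Contraction is a graded derivation
of the wedge product (iprod_wedge), hence the defect at (X, Y) is a derivation in
Y; it is also symmetric up to sign, so the principle propagates its vanishing from
pairs of generators to all pairs (defect_eq0). Conversely, a map from sections to
functions that is linear over the functions comes from a 1-form
(tensorial_pairing), again by means of the cut-off frames. *)

(** * Smooth cut-off functions *)

Section FlatFunction.
Context (R : realType).

(** The powers t^-m are included so that the family is stable, up to linear
combinations, under differentiation. *)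
Definition flat (m : nat) (t : R) : R :=
  if 0 < t then t^-1 ^+ m * expR (- t^-1) else 0.

Lemma flat_le0 m t : t <= 0 -> flat m t = 0.
Proof. by rewrite /flat ltNge => ->. Qed.

Lemma flat_gt0 m t : 0 < t -> 0 < flat m t.
Proof. by move=> t0; rewrite /flat t0 mulr_gt0 ?expR_gt0// exprn_gt0// invr_gt0. Qed.

Lemma flat_ge0 m t : 0 <= flat m t.
Proof. by case: (ltP 0 t) => [/flat_gt0/ltW//|/flat_le0->]. Qed.

(** The order of vanishing at 0 that makes the derivative there exist and be 0: the
exponential at 1/t exceeds the term of degree m + 2 of its series. *)
Lemma flat_bound m t : flat m t <= m.+2`!%:R * t ^+ 2.
Proof.
case: (ltP 0 t) => [t0|/flat_le0->]; last by rewrite mulr_ge0// ?sqr_ge0.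
rewrite /flat t0 expRN.
have ti0 : 0 < t^-1 by rewrite invr_gt0.
have := expR_ge1Dxn m.+1 (ltW ti0).
set e := expR _; set F := m.+2`!%:R => H.
have e0 : 0 < e by exact: expR_gt0.
have F0 : 0 < F by rewrite ltr0n fact_gt0.
rewrite ler_pdivrMr//.
have {}H : t^-1 ^+ m.+2 / F <= e by apply: le_trans H; rewrite lerDr.
rewrite ler_pdivrMr// in H.
rewrite -mulrA mulrCA [F * e]mulrC.
apply: (@le_trans _ _ (t ^+ 2 * t^-1 ^+ m.+2)); last by rewrite ler_pM2l// exprn_gt0.
by rewrite -(addn2 m) exprD mulrCA -exprMn mulfV ?gt_eqF// expr1n mulr1.
Qed.

Lemma flat_derive (m : nat) (t : R) :
  is_derive t 1 (flat m) (- m%:R * flat m.+1 t + flat m.+2 t).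
Proof.
have [t0|t0|->] := ltgtP t 0.
- rewrite !flat_le0 ?ltW// mulr0 addr0.
  apply: near_eq_is_derive (is_derive_cst 0 t 1).
  have neg : \forall s \near t, s < 0 by exact: lt_nbhsl.
  by near=> s; rewrite flat_le0// ltW//; near: s.
- have t0' : t != 0 by rewrite gt_eqF.
  apply: (@near_eq_is_derive R R R (fun s : R => s^-1 ^+ m * expR (- s^-1)) (flat m)).
    have pos : \forall s \near t, 0 < s by exact: lt_nbhsr.
    by near=> s; rewrite /flat ifT//; near: s.
  have d1 : is_derive t 1 (fun s : R => s^-1) (- t ^- 2).
    apply: DeriveDef; first exact: derivableV.
    by rewrite deriveV// derive_id [_ *: _]mulr1.
  have d2 := is_deriveX m d1.
  have d3 := @is_derive1_comp R expR (- (fun s : R => s^-1)) t _ _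
    (is_derive_expR (- t^-1)) (is_deriveN d1).
  have d4 := is_deriveM d2 d3.
  rewrite [X in is_derive _ _ X _](_ : _ =
      ((fun s : R => s^-1) ^+ m) * (expR \o (- (fun s : R => s^-1)))); last first.
    apply/funext => s.
    by rewrite -[RHS]/(((fun s : R => s^-1) ^+ m) s * _) exprfctE.
  apply: (is_derive_eq d4).
  rewrite /flat t0 /= -![_ *: _]/(_ * _) !exprfctE.
  rewrite -[expR ((- _) t)]/(expR (- t^-1)) -exprVn.
  move: (t^-1) (expR _) => i E; case: m {d2 d4} => [|m] /=; first by ring.
  by rewrite !exprS; ring.
- rewrite !flat_le0// mulr0 addr0.
  suff C : (fun h : R => h^-1 *: (flat m (h *: (1 : R) + 0) - flat m 0)) @ 0^'
      --> (0 : R).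
    by apply: DeriveDef; [apply/cvg_ex; exists 0|exact: cvg_lim C].
  apply/cvgr0Pnorm_le => e e0.
  near=> h.
  have h0 : h != 0 by near: h; exact: nbhs_dnbhs_neq.
  rewrite [h *: _]mulr1 addr0 [flat m 0]flat_le0// subr0.
  rewrite -[_ *: _]/(_ * _) normrM normfV [`|flat _ _|]ger0_norm ?flat_ge0//.
  rewrite mulrC ler_pdivrMr ?normr_gt0//.
  apply: le_trans (flat_bound m h) _.
  rewrite -real_normK ?num_real// expr2 mulrA ler_wpM2r//.
  rewrite mulrC -ler_pdivlMr ?ltr0n ?fact_gt0//.
  near: h; apply: dnbhs0_le; by rewrite divr_gt0// ltr0n fact_gt0.
Unshelve. all: by end_near. Qed.

End FlatFunction.

Section ChainRule.
Context (R : realType).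

(** Lets the chain rule on the line apply to functions that are only assumed to have
directional derivatives. *)
Lemma derive_line (V : normedModType R) (h : V -> R) (x v : V) :
  'D_v h x = 'D_1 (fun s : R => h (s *: v + x)) (0 : R).
Proof.
rewrite /derive; set g1 := fun h => h^-1 *: _; set g2 := fun h => h^-1 *: _.
suff -> : g1 = g2 by [].
by rewrite funeqE /g1 /g2 => s /=; rewrite addr0 scale0r add0r [_%:A]mulr1.
Qed.

Lemma is_derive_chain (V : normedModType R) (g : R -> R) (h : V -> R)
    (x v : V) (dg : R) :
  derivable h x v -> is_derive (h x) 1 g dg ->
  is_derive x v (fun y => g (h y)) (dg * 'D_v h x).
Proof.
move=> dh gd; pose l (s : R) := h (s *: v + x).
have l0 : l 0 = h x by rewrite /l scale0r add0r.
have dl : is_derive (0 : R) 1 l ('D_v h x).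
  by rewrite derive_line; apply: derivableP; exact: (proj1 (derivable1P _ _ _)).
have gd' : is_derive (l 0) 1 g dg by rewrite l0.
have [c1 c2] := @is_derive1_comp R g l 0 _ _ gd' dl.
apply: DeriveDef; first exact: (proj2 (derivable1P _ _ _)).
by rewrite derive_line; exact: c2.
Qed.

Lemma is_derive_continuous (g : R -> R) (t dg : R) :
  is_derive t 1 g dg -> {for t, continuous g}.
Proof.
by move=> [gd _]; apply: differentiable_continuous; exact/derivable1_diffP.
Qed.

Context (n : nat).
Implicit Types (U : set 'rV[R]_n) (h : 'rV[R]_n -> R^o).

Lemma class_C_flat k m U h : open U -> class_C k U h ->
  class_C k U (fun x => flat m (h x)).
Proof.
move=> oU; have cont i x : {for x, continuous h} ->
    {for x, continuous (fun y => flat i (h y) : R^o)}.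
  move=> ch; apply: (@continuous_comp _ _ _ h (flat i : R^o -> R^o)) => //.
  exact: is_derive_continuous (flat_derive i (h x)).
elim: k m => [|k IH] m.
  by move=> ch x Ux; apply: cont; exact: ch.
move=> Ch; have [ch dh] := Ch; split=> [x Ux|i]; first by apply: cont; exact: ch.
have [di Ci] := dh i.
have D x : U x -> is_derive x (delta_mx 0 i) (fun y => flat m (h y) : R^o)
    ((- m%:R * flat m.+1 (h x) + flat m.+2 (h x)) * 'D_(delta_mx 0 i) h x).
  by move=> Ux; apply: is_derive_chain; [exact: di|exact: flat_derive].
split=> [x Ux|]; first by have [] := D x Ux.
have Ck := class_CS Ch.
apply: (@class_C_ext _ _ k U (fun x =>
    (- m%:R * flat m.+1 (h x) + flat m.+2 (h x)) * 'D_(delta_mx 0 i) h x) _ oU).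
  by move=> x Ux; have [_ <-] := D x Ux.
apply: class_CM => //; apply: class_CD => //; last exact: (IH m.+2).
by apply: class_CM => //; [exact: class_C_cst|exact: (IH m.+1)].
Qed.

Lemma class_C_inv k U h : open U -> (forall x, U x -> h x != 0) ->
  class_C k U h -> class_C k U (fun x => (h x)^-1).
Proof.
move=> oU h0; elim: k => [|k IH].
  move=> ch x Ux; exact: continuousV (h0 x Ux) (ch x Ux).
move=> Ch; have [ch dh] := Ch; split=> [x Ux|i].
  exact: continuousV (h0 x Ux) (ch x Ux).
have [di Ci] := dh i.
split=> [x Ux|]; first by apply: derivableV; [exact: h0|exact: di].
have Ck := IH (class_CS Ch).
apply: (@class_C_ext _ _ k U
    (fun x => (-1) * (((h x)^-1 * (h x)^-1) * 'D_(delta_mx 0 i) h x)) _ oU).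
  move=> x Ux; rewrite deriveV; [|exact: h0|exact: di].
  by rewrite -[RHS]/(_ * _) mulN1r mulNr -exprVn expr2.
apply: class_CM => //; first exact: class_C_cst.
by apply: class_CM => //; exact: class_CM.
Qed.

End ChainRule.

Section Cutoff.
Context (R : realType) (n : nat) (M : manifold R n).
Implicit Types (W U : set M) (f g : M -> R^o).

Lemma smooth_fun_flat m W f : open W -> smooth_fun_on W f ->
  smooth_fun_on W (fun x => flat m (f x)).
Proof.
by move=> oW sf i k; apply: class_C_flat (sf i k); exact: chart_img_openI.
Qed.

Lemma smooth_fun_inv W f : open W -> (forall x, W x -> f x != 0) ->
  smooth_fun_on W f -> smooth_fun_on W (fun x => (f x)^-1).
Proof.
move=> oW f0 sf i k; apply: class_C_inv (sf i k); first exact: chart_img_openI.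
by move=> _ [x [ix Wx] <-]; rewrite chartK//; exact: f0.
Qed.

Lemma smooth_fun_continuous W f x : open W -> smooth_fun_on W f -> W x ->
  {for x, continuous f}.
Proof.
move=> oW sf Wx; have [i ix] := chart_dom_cover x.
have Px : (chart i @` (chart_dom i `&` W)) (chart i x) by exists x.
have cf := class_C_cont (sf i 0) Px.
have cc := @chart_continuous _ _ M i x ix.
have := continuous_comp cc cf; rewrite /prop_for /continuous_at /= chartK//.
apply: cvg_trans; apply: near_eq_cvg.
apply: filterS (open_nbhs_nbhs (conj (@chart_dom_open _ _ M i) ix)) => y iy /=.
by rewrite chartK.
Qed.

Lemma smooth_chart (i : chart_ix M) (l : 'I_n) :
  smooth_fun_on (chart_dom i) (fun x => chart i x 0 l).
Proof. by move=> j; exact: chart_transition. Qed.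

Lemma smooth_fun_prod (I : finType) W (F : I -> M -> R^o) : open W ->
  (forall i, smooth_fun_on W (F i)) -> smooth_fun_on W (fun x => \prod_i F i x).
Proof.
move=> oW sF; elim: (index_enum I) => [|i s IH].
  rewrite (_ : (fun x => _) = (fun _ => (1 : R))); first exact: smooth_fun_cst.
  by apply/funext => x; rewrite big_nil.
rewrite (_ : (fun x => _) = (fun x => F i x * \prod_(j <- s) F j x)).
  exact: smooth_funM.
by apply/funext => x; rewrite big_cons.
Qed.

(** The second condition is what it means in practice for the support of b to be
closed and contained in W: functions smooth on W only become globally smooth when
multiplied by b. *)
Definition cutoff W (b : Cinf M) : Prop :=
  (forall x, ~ W x -> b x = 0) /\
  (forall U g, open U -> smooth_fun_on (U `&` W) g ->
    smooth_fun_on U (fun x => b x * g x)).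

(** In a chart, b is a product over the coordinates of bumps supported in a segment.
The resulting cube is compact, so its image in the manifold is closed because the
manifold is Hausdorff, and the extension of b by 0 is smooth. *)
Lemma exists_cutoff W x : open W -> W x -> exists2 b, cutoff W b & b x != 0.
Proof.
move=> oW Wx; have [i ix] := chart_dom_cover x.
pose c := chart i x.
have [e /= e0 eP] : exists2 e, 0 < e & ball c e `<=` chart i @` (chart_dom i `&` W).
  have oP := chart_img_openI oW (i := i).
  have : nbhs c (chart i @` (chart_dom i `&` W)).
    by apply: open_nbhs_nbhs; split=> //; exists x.
  by move=> /nbhs_ballP[e e0 eP]; exists e.
pose d := e / 2.
have d0 : 0 < d by rewrite divr_gt0.
pose beta (y : 'rV[R]_n) : R :=
  \prod_l (flat 0 (y 0 l - (c 0 l - d)) * flat 0 (c 0 l + d - y 0 l)).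
pose Q := [set y : 'rV[R]_n | forall l, `[c 0 l - d, c 0 l + d]%classic (y ord0 l)].
have QP : Q `<=` chart i @` (chart_dom i `&` W).
  move=> y Qy; apply: eP; split=> // j l; rewrite (ord1 j).
  have /= := Qy l; rewrite in_itv/= => /andP[h1 h2].
  rewrite /ball/= /ball_/=; apply: (@le_lt_trans _ _ d); last by rewrite /d; lra.
  by rewrite ler_norml; apply/andP; split; lra.
have cQ : compact Q.
  apply: (@rV_compact R n (fun l => `[c 0 l - d, c 0 l + d]%classic)) => l.
  exact: segment_compact.
pose K := chart_inv i @` Q.
have cK : closed K.
  apply: compact_closed; first exact: (@manifold_hausdorff _ _ M).
  apply: continuous_compact cQ; apply: continuous_in_subspaceT => y.
  rewrite inE => /QP[z [iz _] <-].
  by apply: chart_inv_continuous; exists z.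
have KW : K `<=` chart_dom i `&` W.
  by move=> _ [y /QP[z [iz Wz] <-] <-]; rewrite chartK.
pose f y : R := if `[< chart_dom i y >] then beta (chart i y) else 0.
have fK y : ~ K y -> f y = 0.
  move=> nK; rewrite /f; case: asboolP => // iy.
  have /existsNP[l nl] : ~ Q (chart i y).
    by move=> Qy; apply: nK; exists (chart i y) => //; rewrite chartK.
  rewrite /beta (bigD1 l)//=.
  have [h|h] := leP (chart i y 0 l) (c 0 l - d).
    by rewrite flat_le0 ?mul0r// subr_le0.
  have [h'|h'] := leP (c 0 l + d) (chart i y 0 l).
    by rewrite [flat 0 (_ + _ - _)]flat_le0 ?mulr0 ?mul0r// subr_le0.
  by exfalso; apply: nl; rewrite /= in_itv/= !ltW.
have sf : smooth_fun_on (chart_dom i) (f : M -> R^o).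
  have oi := @chart_dom_open _ _ M i.
  apply: (@smooth_fun_ext _ _ _ _ (fun y => beta (chart i y))) => //.
    by move=> y iy; rewrite /f asboolT.
  apply: smooth_fun_prod => // l; have sl := smooth_chart i l.
  apply: smooth_funM => //; apply: smooth_fun_flat => //; apply: smooth_funD => //.
  - exact: smooth_fun_cst.
  - exact: smooth_fun_cst.
  - rewrite (_ : (fun y => _) = (fun y => (-1) * chart i y 0 l)).
      by apply: smooth_funM => //; exact: smooth_fun_cst.
    by apply/funext => y; rewrite mulN1r.
have key U g : open U -> smooth_fun_on (U `&` W) g ->
    smooth_fun_on U (fun x => f x * g x).
  move=> oU sg; apply: smooth_fun_local => y Uy.
  have oi := @chart_dom_open _ _ M i.
  have [Ky|nKy] := pselect (K y).
    have [iy Wy] := KW _ Ky; exists (chart_dom i `&` (U `&` W)) => //.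
    apply: smooth_funM; first by apply: openI => //; exact: openI.
      by apply: smooth_fun_sub sf => z [].
    by apply: smooth_fun_sub sg => z [].
  exists (~` K) => //.
  apply: (@smooth_fun_ext _ _ _ _ (fun _ => 0)); first exact: closed_openC.
    by move=> z nKz; rewrite fK// mul0r.
  exact: smooth_fun_cst.
have sfT : smooth_fun_on setT (f : M -> R^o).
  apply: (@smooth_fun_ext _ _ _ _ (fun y => f y * 1)); first exact: openT.
    by move=> y _; rewrite mulr1.
  by apply: key; [exact: openT|exact: smooth_fun_cst].
exists (mk_sub (W := smooth_subspace M) sfT).
  by split=> // y nW; apply: fK => /KW[].
rewrite -[Cinf_fun _ x]/(f x) /f asboolT// gt_eqF//.
apply: prodr_gt0 => l _; rewrite mulr_gt0//; apply: flat_gt0; rewrite -/c; lra.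
Qed.

End Cutoff.

(** * Interior products of alternating forms *)

(** A permutation is determined by the index that it sends to 0 together with a
permutation of the remaining ones. *)
Lemma sum_lift_perm (V : nmodType) m (F : 'S_m.+1 -> V) :
  \sum_s F s = \sum_j \sum_(t : 'S_m) F (lift_perm j ord0 t).
Proof.
rewrite pair_big /= (reindex (fun x => lift_perm x.1 ord0 x.2))//=.
apply: onW_bij; apply: inj_card_bij.
  move=> [j t] [j' t'] /= E.
  have jj : j = j'.
    have inv0 h u : ((lift_perm h ord0 u : 'S_m.+1)^-1)%g ord0 = h.
      by apply: (canLR (permK _)); rewrite lift_perm_id.
    by rewrite -(inv0 j t) E inv0.
  rewrite -jj in E *; congr pair; apply/permP => i.
  have := congr1 (fun s : 'S_m.+1 => s (lift j i)) E.
  by rewrite !lift_perm_lift => /lift_inj.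
by rewrite card_prod card_ord !card_Sn factS.
Qed.

Section AlternatingCalculus.
Context (R : realType) (V : lmodType R).
Implicit Types (X Y Z : forms V).

Lemma form_ev_tperm X k (v : 'I_k -> V) (i j : 'I_k) : i != j ->
  form_ev X (fun m => v (tperm i j m)) = - form_ev X v.
Proof.
move=> ij; pose w x y := dfwith (dfwith v i x) j y.
have wi x y : w x y i = x by rewrite /w dfwithout 1?eq_sym// dfwithin.
have wj x y : w x y j = y by rewrite /w dfwithin.
have wC x y : w x y = dfwith (dfwith v j y) i x.
  apply/funext => m; have [->|mi] := eqVneq m i.
    by rewrite wi dfwithin.
  have [->|mj] := eqVneq m j.
    by rewrite wj dfwithout// dfwithin.
  by rewrite /w !dfwithout// eq_sym.
have alt x : form_ev X (w x x) = 0.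
  by apply: (form_ev_alt X ij); rewrite wi wj.
have linj x y z : form_ev X (w x (y + z)) = form_ev X (w x y) + form_ev X (w x z).
  by have := form_ev_lin X j (dfwith v i x) 1 y z; rewrite scale1r mul1r.
have lini x y z : form_ev X (w (x + y) z) = form_ev X (w x z) + form_ev X (w y z).
  by rewrite !wC; have := form_ev_lin X i (dfwith v j z) 1 x y; rewrite scale1r mul1r.
have := alt (v i + v j); rewrite linj !lini !alt add0r addr0.
have -> : w (v i) (v j) = v.
  apply/funext => m; have [->|mi] := eqVneq m i; first by rewrite wi.
  have [->|mj] := eqVneq m j; first by rewrite wj.
  by rewrite /w !dfwithout// eq_sym.
have -> : w (v j) (v i) = (fun m => v (tperm i j m)).
  apply/funext => m; case: tpermP => [->|->|/eqP mi /eqP mj]; rewrite ?wi ?wj//.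
  by rewrite /w !dfwithout// eq_sym.
by move/eqP; rewrite addr_eq0 => /eqP.
Qed.

Lemma form_ev_perm X k (v : 'I_k -> V) (s : 'S_k) :
  form_ev X (fun m => v (s m)) = (-1) ^+ s * form_ev X v.
Proof.
have [ts -> {s}] := prod_tpermP s.
elim: ts v => [|[i j] ts IH] v /=.
  move=> _; rewrite big_nil odd_perm1 expr0 mul1r.
  by congr form_ev; apply/funext => m; rewrite perm1.
move=> /andP[ij /IH{}IH]; rewrite /perm.dpair/= in ij.
rewrite big_cons odd_mul_tperm ij signr_addb expr1 mulN1r mulNr -(IH v).
rewrite -(form_ev_tperm X _ ij); congr form_ev; apply/funext => m.
by rewrite permM.
Qed.

Lemma form_ev_eq X k k' (v : 'I_k -> V) (v' : 'I_k' -> V) : k = k' ->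
  (forall (i : 'I_k) (j : 'I_k'), i = j :> nat -> v i = v' j) ->
  form_ev X v = form_ev X v'.
Proof.
move=> kk'; move: v'; rewrite -kk' => v' E.
by congr form_ev; apply/funext => i; exact: E.
Qed.

Definition insert (a : V) k (h : 'I_k.+1) (v : 'I_k -> V) : 'I_k.+1 -> V :=
  fun i => oapp v a (unlift h i).

Lemma insert_at a k (h : 'I_k.+1) (v : 'I_k -> V) : insert a h v h = a.
Proof. by rewrite /insert unlift_none. Qed.

Lemma insert_lift a k (h : 'I_k.+1) (v : 'I_k -> V) i : insert a h v (lift h i) = v i.
Proof. by rewrite /insert liftK. Qed.

Lemma form_ev_insert X a k (h : 'I_k.+1) (v : 'I_k -> V) :
  form_ev X (insert a h v) = (-1) ^+ h * form_ev X (insert a ord0 v).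
Proof.
have -> : insert a h v = (fun m => insert a ord0 v (lift_perm h ord0 1 m)).
  apply/funext => m; case: (unliftP h m) => [m'|] ->.
    by rewrite lift_perm_lift !insert_lift perm1.
  by rewrite lift_perm_id !insert_at.
rewrite form_ev_perm odd_lift_perm odd_perm1 /= !addbF.
by rewrite signr_odd.
Qed.

Lemma insert_dfwith a k (h : 'I_k.+1) (v : 'I_k -> V) i x :
  insert a h (dfwith v i x) = dfwith (insert a h v) (lift h i) x.
Proof.
apply/funext => m; case: (unliftP h m) => [m'|] ->.
  rewrite insert_lift; have [->|mi] := eqVneq i m'; first by rewrite !dfwithin.
  by rewrite !dfwithout ?insert_lift// (inj_eq lift_inj).
by rewrite insert_at dfwithout ?insert_at// eq_sym neq_lift.
Qed.

Definition iprod_fun (a : V) X k (v : 'I_k -> V) : R :=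
  form_ev X (insert a ord0 v).

Lemma iprod_alternating a X k : is_alternating (@iprod_fun a X k).
Proof.
split=> [i v c x y|v i j ij vij]; rewrite /iprod_fun.
  by rewrite !insert_dfwith form_ev_lin.
apply: (form_ev_alt X (i := lift ord0 i) (j := lift ord0 j)).
  by rewrite (inj_eq lift_inj).
by rewrite !insert_lift.
Qed.

Definition iprod (a : V) X : forms V :=
  fun k => mk_sub (W := alt_subspace V k) (@iprod_alternating a X k).

Lemma iprodE a X k (v : 'I_k -> V) :
  form_ev (iprod a X) v = form_ev X (insert a ord0 v).
Proof. by []. Qed.

Definition of_degree (p : nat) X :=
  forall k (v : 'I_k -> V), k != p -> form_ev X v = 0.

Lemma of_degree_iprod a p X : of_degree p.+1 X -> of_degree p (iprod a X).
Proof. by move=> hX k v kp; rewrite iprodE hX. Qed.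

Lemma iprod_degree0 a X k (v : 'I_k -> V) :
  of_degree 0 X -> form_ev (iprod a X) v = 0.
Proof. by move=> hX; rewrite iprodE hX. Qed.

(** The splitting of the arguments in a wedge product, with q a free parameter: a
difference n - p in types would obstruct the induction steps on p and q. *)
Definition lo p q n (e : (p + q)%N = n) (i : 'I_p) : 'I_n := cast_ord e (lshift q i).
Definition hi p q n (e : (p + q)%N = n) (i : 'I_q) : 'I_n := cast_ord e (rshift p i).

Lemma sum_lo_hi (U : nmodType) p q n (e : (p + q)%N = n) (F : 'I_n -> U) :
  \sum_j F j = \sum_(i < p) F (lo e i) + \sum_(i < q) F (hi e i).
Proof.
case: n / e F => F; rewrite big_split_ord.
by congr (_ + _); apply: eq_bigr => i _; rewrite /lo /hi cast_ord_id.
Qed.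

(** Only one bidegree contributes when the left factor is homogeneous. *)
Lemma wedge_degree X Y p q n (e : (p + q)%N = n) (v : 'I_n -> V) : of_degree p X ->
  form_ev (wedge X Y) v = (p`! * q`!)%:R^-1 *
    \sum_(s : 'S_n) (-1) ^+ s *
      (form_ev X (fun i => v (s (lo e i))) * form_ev Y (fun j => v (s (hi e j)))).
Proof.
move=> hX; rewrite -[LHS]/(wedge_fun X Y v) /wedge_fun.
have pn : (p < n.+1)%N by rewrite ltnS -e leq_addr.
rewrite (bigD1 (Ordinal pn))//= [X in _ + X]big1 ?addr0; last first.
  move=> i ip; rewrite big1 ?mulr0// => s _; rewrite hX ?mul0r ?mulr0//.
have nq : (n - p)%N = q by rewrite -e addKn.
congr (_ * _); first by rewrite nq.
apply: eq_bigr => s _; congr (_ * (_ * _)).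
  by congr form_ev; apply/funext => i; congr (v (s _)); apply: val_inj.
apply: form_ev_eq => // i j ij; congr (v (s _)); apply: val_inj => /=.
by rewrite ij.
Qed.

Lemma wedge_degree_gt X Y p n (v : 'I_n -> V) : of_degree p X -> (n < p)%N ->
  form_ev (wedge X Y) v = 0.
Proof.
move=> hX np; rewrite -[LHS]/(wedge_fun X Y v) /wedge_fun big1// => i _.
rewrite big1 ?mulr0// => s _; rewrite hX ?mul0r ?mulr0//.
by rewrite neq_ltn (leq_ltn_trans (leq_ord i)).
Qed.

End AlternatingCalculus.

Section InteriorProductWedge.
Context (R : realType) (V : lmodType R).
Implicit Types (X Y Z : forms V).

Lemma insert_lo_lo p q m (e : (p.+1 + q)%N = m.+1) (e' : (p + q)%N = m)
    (a : V) (w : 'I_m -> V) (j : 'I_p.+1) :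
  (fun i => insert a (lo e j) w (lo e i)) = insert a j (fun i => w (lo e' i)).
Proof.
apply/funext => i; case: (unliftP j i) => [i'|] ->; last by rewrite !insert_at.
rewrite insert_lift -(insert_lift a (lo e j) w (lo e' i')).
by congr insert; apply: val_inj.
Qed.

Lemma insert_lo_hi p q m (e : (p.+1 + q)%N = m.+1) (e' : (p + q)%N = m)
    (a : V) (w : 'I_m -> V) (j : 'I_p.+1) :
  (fun i => insert a (lo e j) w (hi e i)) = (fun i => w (hi e' i)).
Proof.
apply/funext => i; rewrite -(insert_lift a (lo e j) w (hi e' i)).
congr insert; apply: val_inj => /=.
by rewrite /bump (leq_trans (leq_ord j)) ?leq_addr.
Qed.

Lemma insert_hi_hi p q m (e : (p + q.+1)%N = m.+1) (e' : (p + q)%N = m)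
    (a : V) (w : 'I_m -> V) (j : 'I_q.+1) :
  (fun i => insert a (hi e j) w (hi e i)) = insert a j (fun i => w (hi e' i)).
Proof.
apply/funext => i; case: (unliftP j i) => [i'|] ->; last by rewrite !insert_at.
rewrite insert_lift -(insert_lift a (hi e j) w (hi e' i')).
by congr insert; apply: val_inj; rewrite /= bumpDl.
Qed.

Lemma insert_hi_lo p q m (e : (p + q.+1)%N = m.+1) (e' : (p + q)%N = m)
    (a : V) (w : 'I_m -> V) (j : 'I_q.+1) :
  (fun i => insert a (hi e j) w (lo e i)) = (fun i => w (lo e' i)).
Proof.
apply/funext => i; rewrite -(insert_lift a (hi e j) w (lo e' i)).
congr insert; apply: val_inj => /=.
by rewrite /bump leqNgt (leq_trans (ltn_ord i)) ?leq_addr.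
Qed.

(** The terms of X /\ Y in which the inserted vector a is an argument of X: moving a
to the front of X cancels the sign of its position, so all p positions contribute
the same amount and p/p! = 1/(p - 1)!. *)
Lemma sum_iprod_lo X Y p q m (e : (p + q)%N = m.+1) (a : V) (v : 'I_m -> V) :
  of_degree p X ->
  (p`! * q`!)%:R^-1 * (\sum_(j < p) \sum_(t : 'S_m) (-1) ^+ (lo e j + t)%N *
    (form_ev X (fun i => insert a (lo e j) (fun l => v (t l)) (lo e i)) *
     form_ev Y (fun i => insert a (lo e j) (fun l => v (t l)) (hi e i)))) =
  form_ev (wedge (iprod a X) Y) v.
Proof.
case: p e => [|p] e hX.
  rewrite big_ord0 mulr0 -[RHS]/(wedge_fun _ _ _) /wedge_fun big1// => i _.
  by rewrite big1 ?mulr0// => s _; rewrite iprod_degree0// mul0r mulr0.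
have e' : (p + q)%N = m by move: e; rewrite addSn => -[].
rewrite (wedge_degree _ e' v (of_degree_iprod a hX)).
pose T : R := \sum_(t : 'S_m) (-1) ^+ t *
  (form_ev (iprod a X) (fun i => v (t (lo e' i))) *
   form_ev Y (fun j => v (t (hi e' j)))).
rewrite -/T (eq_bigr (fun _ => T)) => [|j _]; last first.
  apply: eq_bigr => t _; rewrite (insert_lo_lo _ e') (insert_lo_hi _ e').
  rewrite form_ev_insert -iprodE exprD /=.
  by rewrite -!mulrA [LHS]mulrCA signrMK.
rewrite sumr_const card_ord -(mulr_natr T) [T * _]mulrC mulrA; congr (_ * _).
rewrite factS !natrM; field.
by rewrite nat1r !pnatr_eq0 -!lt0n !fact_gt0.
Qed.

(** The terms in which a is an argument of Y: moving a to the front of Y leaves the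
sign of its passage over the p arguments of X. *)
Lemma sum_iprod_hi X Y p q m (e : (p + q)%N = m.+1) (a : V) (v : 'I_m -> V) :
  of_degree p X ->
  (p`! * q`!)%:R^-1 * (\sum_(j < q) \sum_(t : 'S_m) (-1) ^+ (hi e j + t)%N *
    (form_ev X (fun i => insert a (hi e j) (fun l => v (t l)) (lo e i)) *
     form_ev Y (fun i => insert a (hi e j) (fun l => v (t l)) (hi e i)))) =
  (-1) ^+ p * form_ev (wedge X (iprod a Y)) v.
Proof.
case: q e => [|q] e hX.
  rewrite big_ord0 mulr0 (wedge_degree_gt _ _ hX) ?mulr0//.
  by rewrite -[p]addn0 e.
have e' : (p + q)%N = m by move: e; rewrite addnS => -[].
rewrite (wedge_degree _ e' v hX).
pose T : R := \sum_(t : 'S_m) (-1) ^+ t *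
  (form_ev X (fun i => v (t (lo e' i))) *
   form_ev (iprod a Y) (fun j => v (t (hi e' j)))).
rewrite -/T (eq_bigr (fun _ => (-1) ^+ p * T)) => [|j _]; last first.
  rewrite mulr_sumr; apply: eq_bigr => t _.
  rewrite (insert_hi_lo _ e') (insert_hi_hi _ e') form_ev_insert -iprodE.
  rewrite /= !exprD -!mulrA; congr (_ * _).
  by rewrite [LHS]mulrCA [X in _ * X = _]mulrCA signrMK.
rewrite sumr_const card_ord -(mulr_natr (_ * T)) mulrC -!mulrA; congr (_ * _).
rewrite [RHS]mulrC; congr (_ * _).
rewrite factS !natrM; field.
by rewrite nat1r !pnatr_eq0 -!lt0n !fact_gt0.
Qed.

(** Contraction is a graded derivation: the permutations are sorted according to
the position at which they place the contracted vector. *)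
Lemma iprod_wedge X Y p a k (v : 'I_k -> V) : of_degree p X ->
  form_ev (iprod a (wedge X Y)) v =
  form_ev (wedge (iprod a X) Y) v +
    (-1) ^+ p * form_ev (wedge X (iprod a Y)) v.
Proof.
move=> hX; rewrite iprodE.
have [kp|pk] := ltnP k.+1 p.
  rewrite (wedge_degree_gt _ _ hX)// (wedge_degree_gt _ _ hX) ?(ltnW kp)//.
  case: p hX kp => // p hX kp.
  by rewrite (wedge_degree_gt _ _ (of_degree_iprod a hX))// mulr0 addr0.
have e : (p + (k.+1 - p))%N = k.+1 by rewrite subnKC.
rewrite (wedge_degree _ e _ hX) sum_lift_perm (sum_lo_hi e) mulrDr.
rewrite -(sum_iprod_lo Y e a v hX) -(sum_iprod_hi Y e a v hX).
have ins (j : 'I_k.+1) (t : 'S_k) i :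
    insert a ord0 v (lift_perm j ord0 t i) = insert a j (fun l => v (t l)) i.
  case: (unliftP j i) => [i'|] ->; first by rewrite lift_perm_lift !insert_lift.
  by rewrite lift_perm_id !insert_at.
have sgn (j : 'I_k.+1) (t : 'S_k) :
    (-1) ^+ (lift_perm j ord0 t : bool) = (-1) ^+ (j + t)%N :> R.
  by rewrite odd_lift_perm /= addbF signr_addb signr_odd exprD.
by congr (_ * _ + _ * _); apply: eq_bigr => j _; apply: eq_bigr => t _;
  rewrite sgn; congr (_ * (_ * _)); congr form_ev; apply/funext => i;
  exact: ins.
Qed.

Lemma form_evZ (c : R) X k (v : 'I_k -> V) : form_ev (c *: X) v = c * form_ev X v.
Proof. by []. Qed.

Lemma wedge_form0 (c : R) Y : wedge (form0 V c) Y = c *: Y.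
Proof.
apply: formsP => k v; have h0 : of_degree 0 (form0 V c) by move=> [].
rewrite (wedge_degree Y (add0n k) v h0) mul1n.
rewrite (eq_bigr (fun _ => c * form_ev Y v)) => [|s _]; last first.
  rewrite -[form_ev (form0 _ _) _]/c.
  rewrite (_ : (fun j => _) = (fun j => v (s j))).
    by rewrite form_ev_perm mulrCA signrMK.
  by apply/funext => j; congr (v (s _)); apply: val_inj.
rewrite sumr_const -[in LHS](mulr_natl _ #|_|) card_Sn mulKf.
  exact/esym/form_evZ.
by rewrite pnatr_eq0 -lt0n fact_gt0.
Qed.

(** Summing over i reconstitutes, in the first argument of X, the vector on which
l_i was evaluated; each permutation then gives back X itself. *)
Lemma euler_identity (I : finType) (l : I -> {linear V -> R^o}) (e : I -> V)
    (c : R) X k (v : 'I_k.+1 -> V) :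
  (forall u : V, \sum_i (l i u : R) *: e i = c *: u) ->
  \sum_i form_ev (wedge (form1 (l i)) (iprod (e i) X)) v =
    (k.+1%:R * c) * form_ev X v.
Proof.
move=> le; have h1 f : of_degree 1 (form1 f : forms V) by move=> [|[|j]].
have evE (i : I) : form_ev (wedge (form1 (l i)) (iprod (e i) X)) v =
    k`!%:R^-1 * \sum_(s : 'S_k.+1) (-1) ^+ s * (l i (v (s ord0)) *
      form_ev X (insert (e i) ord0 (fun j => v (s (lift ord0 j))))).
  rewrite (wedge_degree _ (add1n k) v (h1 _)) mul1n.
  congr (_ * _); apply: eq_bigr => s _; congr (_ * (_ * _)).
    by rewrite -[LHS]/(l i _); congr (l i (v (s _))); apply: val_inj.
  rewrite iprodE; congr form_ev; apply/funext => j.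
  case: (unliftP ord0 j) => [j'|] ->; last by rewrite !insert_at.
  by rewrite !insert_lift; congr (v (s _)); apply: val_inj.
under eq_bigr do rewrite evE.
rewrite -mulr_sumr exchange_big /= (eq_bigr (fun _ => c * form_ev X v)).
  rewrite sumr_const -[in LHS](mulr_natl _ #|_|) card_Sn factS natrM.
  have : k`!%:R != 0 :> R by rewrite pnatr_eq0 -lt0n fact_gt0.
  by move=> ?; field.
move=> s _; rewrite -mulr_sumr.
have ins (x : V) : insert x ord0 (fun j => v (s (lift ord0 j))) =
    dfwith (fun j => v (s j)) ord0 x.
  apply/funext => j; case: (unliftP ord0 j) => [j'|] ->.
    by rewrite insert_lift dfwithout// neq_lift.
  by rewrite insert_at dfwithin.
under eq_bigr do rewrite ins.
rewrite -form_ev_sum le; have := form_ev_lin X ord0 (fun j => v (s j)) c (v (s ord0)) 0.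
rewrite addr0 => ->.
have -> : form_ev X (dfwith (fun j => v (s j)) ord0 0) = 0.
  have := form_ev_lin X ord0 (fun j => v (s j)) (-1) 0 0.
  by rewrite scaler0 addr0 mulN1r addNr.
rewrite addr0.
have -> : dfwith (fun j => v (s j)) ord0 (v (s ord0)) = (fun j => v (s j)).
  by apply/funext => j; case: dfwithP.
by rewrite form_ev_perm mulrCA signrMK.
Qed.

End InteriorProductWedge.

(** * Contraction of fields of forms *)

Section FormSections.
Context (R : realType) (n : nat) (M : manifold R n) (r : nat).
Context (E : vector_bundle M r).
Implicit Types (w : form_sections E) (s : sections E).

Lemma iprod_smooth s w :
  is_smooth_form (fun x => iprod (section_at s x) (form_at w x)).
Proof.
move=> a k I; have oa := triv_dom_open a.
pose J l (j : 'I_k.+1) := oapp I l (unlift ord0 j).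
apply: (@smooth_fun_ext _ _ _ _ (fun x => \sum_l
    triv a x (section_at s x) 0 l *
      form_ev (form_at w x) (fun j => frame a x (J l j)))) => //.
  move=> x ax; rewrite iprodE.
  have ins u : insert u ord0 (fun j => frame a x (I j)) =
      dfwith (insert 0 ord0 (fun j => frame a x (I j))) ord0 u.
    apply/funext => j; case: (unliftP ord0 j) => [j'|] ->.
      by rewrite dfwithout ?neq_lift// !insert_lift.
    by rewrite dfwithin insert_at.
  rewrite ins {2}(frame_expand (section_at s x) ax) form_ev_sum.
  apply: eq_bigr => l _; congr (_ * _); rewrite -ins; congr form_ev.
  apply/funext => j; case: (unliftP ord0 j) => [j'|] ->.
    by rewrite insert_lift /J liftK.
  by rewrite insert_at /J unlift_none.
apply: smooth_fun_sum => // l; apply: smooth_funM => //; first exact: (sub_ofP s).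
exact: (sub_ofP w).
Qed.

Definition form_iprod s w : form_sections E :=
  mk_sub (W := form_subspace E) (iprod_smooth s w).

Lemma form_iprod_ev s w x k (v : 'I_k -> E x) :
  form_ev (form_at (form_iprod s w) x) v =
  form_ev (form_at w x) (insert (section_at s x) ord0 v).
Proof. by []. Qed.

Lemma form_at_D w w' x k (v : 'I_k -> E x) :
  form_ev (form_at (w + w') x) v = form_ev (form_at w x) v + form_ev (form_at w' x) v.
Proof. by []. Qed.

Lemma form_at_Z (c : R) w x k (v : 'I_k -> E x) :
  form_ev (form_at (c *: w) x) v = c * form_ev (form_at w x) v.
Proof. by []. Qed.

Lemma homogeneous_of_degree (p : nat) w x :
  homogeneous p%:Z w -> of_degree p (form_at w x).
Proof. by move=> hw k v kp; apply: hw. Qed.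

Lemma homogeneous_lt0 (d : int) w : d < 0 -> homogeneous d w -> w = 0.
Proof.
move=> d0 hw; apply: form_sectionsP => x k v.
rewrite hw//; apply: contraTneq d0 => <-; by rewrite -leNgt.
Qed.

(** Lets the identities stated for natural degrees be used for the integer degrees
that arise from contractions and brackets of functions. *)
Lemma homogeneous_cases (d : int) w : homogeneous d w ->
  (exists p : nat, d = p%:Z) \/ w = 0.
Proof.
case: d => p hw; first by left; exists p.
by right; apply: homogeneous_lt0 hw.
Qed.

Lemma homogeneous_iprod s (d : int) w :
  homogeneous d w -> homogeneous (d - 1) (form_iprod s w).
Proof.
move=> hw k x v kp; rewrite form_iprod_ev hw//.
by apply: contra_neq kp => <-; rewrite -addn1 PoszD addrK.
Qed.

Lemma form_iprodP s c w w' :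
  form_iprod s (c *: w + w') = c *: form_iprod s w + form_iprod s w'.
Proof. exact: form_sectionsP. Qed.

Lemma form_iprod0 s : form_iprod s 0 = 0.
Proof. exact: (comb0 (form_iprodP s)). Qed.

Lemma form_iprodD s w w' : form_iprod s (w + w') = form_iprod s w + form_iprod s w'.
Proof. by rewrite -[w]scale1r form_iprodP !scale1r. Qed.

Lemma form_iprodZ s c w : form_iprod s (c *: w) = c *: form_iprod s w.
Proof. by rewrite -[c *: w]addr0 form_iprodP form_iprod0 addr0. Qed.

Lemma form_wedge0l w : form_wedge 0 w = 0.
Proof. exact: (comb0 (fun c w1 w2 => form_wedge_combl c w1 w2 w)). Qed.

Lemma form_wedge0r w : form_wedge w 0 = 0.
Proof. exact: (comb0 (fun c w1 w2 => form_wedge_combr c w w1 w2)). Qed.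

Lemma form_wedgeDl w w' z : form_wedge (w + w') z = form_wedge w z + form_wedge w' z.
Proof. by rewrite -[w]scale1r form_wedge_combl !scale1r. Qed.

Lemma form_wedgeZl c w z : form_wedge (c *: w) z = c *: form_wedge w z.
Proof. by rewrite -[c *: w]addr0 form_wedge_combl form_wedge0l addr0. Qed.

Lemma form_wedgeDr w w' z : form_wedge z (w + w') = form_wedge z w + form_wedge z w'.
Proof. by rewrite -[w]scale1r form_wedge_combr !scale1r. Qed.

Lemma form_wedgeZr c w z : form_wedge z (c *: w) = c *: form_wedge z w.
Proof. by rewrite -[c *: w]addr0 form_wedge_combr form_wedge0r addr0. Qed.

Lemma form_wedge_fun (f : Cinf M) w x k (v : 'I_k -> E x) :
  form_ev (form_at (form_wedge (form_fun E f) w) x) v =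
  f x * form_ev (form_at w x) v.
Proof.
by rewrite -[form_at (form_wedge _ _) x]/(wedge (form0 (E x) (f x)) _) wedge_form0.
Qed.

Lemma form_fun_homogeneous (f : Cinf M) : homogeneous 0%:Z (form_fun E f).
Proof. by move=> [|k] x v. Qed.

Lemma homogeneous0_fun w : homogeneous 0%:Z w ->
  w = form_fun E (form_eval w (fun i : 'I_0 => 0)).
Proof.
move=> hw; apply: form_sectionsP => x [|k] v; last by rewrite hw.
by rewrite -[RHS]/(form_ev _ _); congr form_ev; apply/funext => -[].
Qed.

Lemma form_iprod_wedge s (d : int) w w' : homogeneous d w ->
  form_iprod s (form_wedge w w') =
  form_wedge (form_iprod s w) w' + (-1) ^ d *: form_wedge w (form_iprod s w').
Proof.
move=> hw; have [[p dp]|->] := homogeneous_cases hw; last first.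
  by rewrite !form_wedge0l form_iprod0 form_wedge0l scaler0 addr0.
rewrite dp in hw *.
apply: form_sectionsP => x k v; rewrite form_at_D form_at_Z.
exact: (iprod_wedge (form_at w' x) (section_at s x) v
  (homogeneous_of_degree hw (x := x))).
Qed.

Lemma linear_dependence (m k : nat) (v : 'I_k -> 'rV[R]_m) : (m < k)%N ->
  exists2 c : 'I_k -> R, (exists i, c i != 0) & \sum_j c j *: v j = 0.
Proof.
move=> mk; pose B : 'M[R]_(k, m) := \matrix_j v j.
have : kermx B != 0.
  rewrite kermx_eq0 /row_free neq_ltn (leq_ltn_trans _ mk)//.
  exact: rank_leq_col.
move=> /rowV0Pn[u uB u0]; exists (fun j => u 0 j).
  by have /rV0Pn[i ui] := u0; exists i.
have /sub_kermxP := uB; rewrite mulmx_sum_row => uB0; rewrite -[RHS]uB0.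
by apply: eq_bigr => j _; rewrite rowK.
Qed.

(** Forms are a product over all degrees; this makes every field of forms a finite
sum of homogeneous ones. *)
Lemma form_ev_gt_rank w x k (v : 'I_k -> E x) : (r < k)%N ->
  form_ev (form_at w x) v = 0.
Proof.
move=> rk; have [a ax] := triv_dom_cover E x.
have [c [i ci] cv] := linear_dependence (fun j => triv a x (v j)) rk.
have {}cv : \sum_j c j *: v j = 0.
  rewrite -[LHS](trivK ax) linear_sum /=.
  under eq_bigr do rewrite linearZ.
  by rewrite cv linear0.
have := form_ev_sum (form_at w x) i v c v; rewrite cv.
have := form_ev_lin (form_at w x) i v (-1) 0 0.
rewrite scaler0 addr0 mulN1r addNr => ->.
rewrite (bigD1 i)//= [X in _ + X]big1 ?addr0.
  have -> : dfwith v i (v i) = v by apply/funext => j; case: dfwithP.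
  by move/esym/eqP; rewrite mulf_eq0 (negPf ci) => /eqP.
move=> j ji; rewrite (form_ev_alt _ (i := i) (j := j)) ?mulr0//.
  by rewrite eq_sym.
by rewrite dfwithin dfwithout// eq_sym.
Qed.

Definition part_at (p : nat) w : dprod (fun x : M => forms (E x)) :=
  fun x k => (k == p)%:R *: form_at w x k.

Lemma part_atE p w x k (v : 'I_k -> E x) :
  form_ev (part_at p w x) v = (k == p)%:R * form_ev (form_at w x) v.
Proof. by []. Qed.

Lemma part_smooth p w : is_smooth_form (part_at p w).
Proof.
move=> a k I; have oa := triv_dom_open a.
rewrite (_ : (fun x => _) = (fun x =>
    (k == p)%:R * form_ev (form_at w x) (fun j => frame a x (I j)))).
  by apply: smooth_funM => //; [exact: smooth_fun_cst|exact: (sub_ofP w)].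
by apply/funext => x; exact: part_atE.
Qed.

Definition part p w : form_sections E := mk_sub (W := form_subspace E) (part_smooth p w).

Lemma homogeneous_part p w : homogeneous p%:Z (part p w).
Proof. by move=> k x v kp; rewrite [LHS]part_atE (negPf (kp : k != p)) mul0r. Qed.

Lemma form_at_sum (I : finType) (F : I -> form_sections E) x k (v : 'I_k -> E x) :
  form_ev (form_at (\sum_i F i) x) v = \sum_i form_ev (form_at (F i) x) v.
Proof. by elim/big_ind2 : _ => // w c w' c' <- <-. Qed.

Lemma sum_parts w : w = \sum_(p < r.+1) part p w.
Proof.
apply: form_sectionsP => x k v; rewrite form_at_sum.
have [kr|rk] := ltnP k r.+1.
  rewrite (bigD1 (Ordinal kr))//= [X in _ = _ + X]big1 ?addr0.
    by rewrite [RHS]part_atE eqxx mul1r.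
  move=> i ik; rewrite [LHS]part_atE.
  by rewrite (_ : (k == i) = false) ?mul0r// eq_sym; apply: contraNF ik.
rewrite form_ev_gt_rank// big1// => p _; by rewrite form_ev_gt_rank.
Qed.

End FormSections.

(** * Cut-off frames and derivations of multivectors *)

Section CutoffFrame.
Context (R : realType) (n : nat) (M : manifold R n) (r : nat).
Context (E : vector_bundle M r) (a : triv_ix E) (b : Cinf M).
Hypothesis hb : cutoff (triv_dom a) b.

Lemma cutoff_frame_smooth i :
  is_smooth_section (fun x => b x *: frame a x i : E x).
Proof.
move=> a' j; have [_ ext] := hb.
rewrite (_ : (fun x => _) = (fun x => b x * triv a' x (frame a x i) 0 j)).
  apply: ext; first exact: triv_dom_open.
  by rewrite setIC; exact: triv_transition.
by apply/funext => x; rewrite linearZ mxE.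
Qed.

Definition cutoff_frame i : sections E :=
  mk_sub (W := section_subspace E) (cutoff_frame_smooth i).

Lemma cutoff_frameE i x : section_at (cutoff_frame i) x = b x *: frame a x i.
Proof. by []. Qed.

Lemma cutoff_coord_smooth (s : sections E) i :
  smooth_fun_on setT (fun x => b x * triv a x (section_at s x) 0 i).
Proof.
have [_ ext] := hb; apply: ext; first exact: openT.
by rewrite setTI; exact: (sub_ofP s).
Qed.

Definition cutoff_coord (s : sections E) i : Cinf M :=
  mk_sub (W := smooth_subspace M) (cutoff_coord_smooth s i).

Lemma sections_sum (I : finType) (F : I -> sections E) x :
  section_at (\sum_i F i) x = \sum_i section_at (F i) x.
Proof. by elim/big_ind2 : _ => // w c w' c' <- <-. Qed.

Lemma sectionsP (s t : sections E) : (forall x, section_at s x = section_at t x) -> s = t.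
Proof. by move=> st; apply: val_inj; apply: functional_extensionality_dep. Qed.

(** Multiplication by b^2, one factor for the coefficients and one for the frame,
makes the local expansion of a section global. *)
Lemma cutoff_section_expand (s : sections E) :
  section_mul (Cinf_mul b b) s =
  \sum_i section_mul (cutoff_coord s i) (cutoff_frame i).
Proof.
apply: sectionsP => x; rewrite sections_sum.
have [ax|nax] := pselect (triv_dom a x).
  rewrite -[LHS]/((b x * b x) *: section_at s x) {1}(frame_expand (section_at s x) ax).
  rewrite scaler_sumr; apply: eq_bigr => i _.
  rewrite -[RHS]/((b x * triv a x (section_at s x) 0 i) *: (b x *: frame a x i)).
  by rewrite !scalerA; congr (_ *: _); ring.
have [b0 _] := hb.
rewrite -[LHS]/((b x * b x) *: section_at s x) b0// mul0r scale0r big1// => i _.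
by rewrite -[LHS]/((b x * _) *: _) b0// mul0r scale0r.
Qed.

End CutoffFrame.

Section Multivectors.
Context (R : realType) (n : nat) (M : manifold R n) (r : nat).
Context (A : vector_bundle M r).
Local Notation mv := (multivectors A).

Lemma mv_sectionE (u : sections A) x (v : 'I_1 -> dual_fiber A x) :
  form_ev (form_at (mv_section u) x) v = (v ord0 : 'Hom(A x, R^o)) (section_at u x).
Proof. by []. Qed.

Lemma mv_section_homogeneous (u : sections A) : homogeneous 1%:Z (mv_section u).
Proof. by move=> [|[|k]] x v. Qed.

Lemma mv_section_linear c (u v : sections A) :
  mv_section (c *: u + v) = c *: mv_section u + mv_section v.
Proof.
apply: form_sectionsP => x [|[|k]] w; rewrite form_at_D form_at_Z.
- by rewrite !(mv_section_homogeneous _ (k := 0))// mulr0 addr0.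
- by rewrite !mv_sectionE -linearP.
- by rewrite !(mv_section_homogeneous _ (k := k.+2))// mulr0 addr0.
Qed.

Lemma mv_section_mul (f : Cinf M) (u : sections A) :
  mv_section (section_mul f u) = form_wedge (mv_fun A f) (mv_section u).
Proof.
apply: form_sectionsP => x k w; rewrite form_wedge_fun; case: k w => [|[|k]] w.
- by rewrite !(mv_section_homogeneous _ (k := 0))// mulr0.
- by rewrite !mv_sectionE -linearZ.
- by rewrite !(mv_section_homogeneous _ (k := k.+2))// mulr0.
Qed.

Lemma mv_funP c (f g : Cinf M) :
  mv_fun A (c *: f + g) = c *: mv_fun A f + mv_fun A g.
Proof.
apply: form_sectionsP => x [|k] w; first by [].
rewrite form_at_D form_at_Z.
by rewrite !(form_fun_homogeneous (E := dual_bundle A) _ (k := k.+1))// mulr0 addr0.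
Qed.

Lemma mv_funN (f : Cinf M) : mv_fun A (- f) = - mv_fun A f.
Proof.
rewrite -scaleN1r -[-1 *: f]addr0 mv_funP (comb0 mv_funP) addr0.
by rewrite scaleN1r.
Qed.

Lemma mv_funB (f g : Cinf M) : mv_fun A (f - g) = mv_fun A f - mv_fun A g.
Proof. by rewrite -[f]scale1r mv_funP mv_funN !scale1r. Qed.

Section Euler.
Context (a : triv_ix A) (b : Cinf M) (hb : cutoff (triv_dom a) b).

Definition cutoff_coframe i : sections (dual_bundle A) :=
  @cutoff_frame _ _ _ _ (dual_bundle A) a b hb i.

Lemma cutoff_coframe_expand x (xi : dual_fiber A x) :
  \sum_i (ev_at (section_at (cutoff_frame hb i) x) xi : R) *:
    section_at (cutoff_coframe i) x = (b x * b x) *: xi.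
Proof.
have [ax|nax] := pselect (triv_dom a x).
  rewrite [in RHS](@frame_expand _ _ _ _ (dual_bundle A) a x xi ax).
  rewrite scaler_sumr; apply: eq_bigr => i _.
  rewrite [section_at (cutoff_coframe i) x]cutoff_frameE cutoff_frameE.
  rewrite !scalerA; congr (_ *: _).
  rewrite /ev_at linearZ -[X in _ = _ * X]/(dual_triv a x xi 0 i) lfunE mxE.
  by rewrite -[LHS]/((b x * xi (frame a x i)) * b x) mulrAC.
have [b0 _] := hb; rewrite b0// mul0r scale0r big1// => i _.
by rewrite [section_at (cutoff_coframe i) x]cutoff_frameE b0// scale0r scaler0.
Qed.

Lemma cutoff_euler (X : mv) (k : nat) : homogeneous k.+1%:Z X ->
  \sum_i form_wedge (mv_section (cutoff_frame hb i)) (form_iprod (cutoff_coframe i) X) =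
  k.+1%:R *: form_wedge (mv_fun A (Cinf_mul b b)) X.
Proof.
move=> hX; apply: form_sectionsP => x [|m] v.
  rewrite form_at_Z form_wedge_fun hX// !mulr0 form_at_sum big1// => i _.
  exact: (wedge_degree_gt _ _ (homogeneous_of_degree (mv_section_homogeneous _) (x := x))).
rewrite form_at_Z form_wedge_fun form_at_sum.
have := euler_identity (form_at X x) v (@cutoff_coframe_expand x).
rewrite -[Cinf_fun (Cinf_mul b b) x]/(b x * b x) => H.
have [mk|mk] := eqVneq m k; first by rewrite mulrA -mk.
rewrite hX in H *; last by rewrite eqz_nat eqSS.
by rewrite !mulr0 in H *.
Qed.

End Euler.

(** The Euler identity exhibits b^2 X, up to a constant, as a sum of products of a
section with a multivector of smaller degree. The coefficient c 0 being nonzero,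
D X can be recovered from D (b^2 X) at the points where b does not vanish. *)
Lemma derivation_eq0 (D : mv -> mv) (c : nat -> R) :
  (forall (s : R) (X Y : mv), D (s *: X + Y) = s *: D X + D Y) ->
  c 0%N != 0 ->
  (forall (q : nat) (Y Z : mv), homogeneous q%:Z Y ->
     D (form_wedge Y Z) = form_wedge (D Y) Z + c q *: form_wedge Y (D Z)) ->
  (forall f : Cinf M, D (mv_fun A f) = 0) ->
  (forall u : sections A, D (mv_section u) = 0) ->
  forall X, D X = 0.
Proof.
move=> Dl c0 DW Df Du.
have D0 : D 0 = 0 by exact: comb0.
have DZ s X : D (s *: X) = s *: D X by rewrite -[s *: X]addr0 Dl D0 addr0.
have Dsum (I : finType) (F : I -> mv) : D (\sum_i F i) = \sum_i D (F i).
  elim: (index_enum I) => [|i s IH]; first by rewrite !big_nil.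
  by rewrite !big_cons -[F i]scale1r Dl IH !scale1r.
suff hom k X : homogeneous k%:Z X -> D X = 0.
  move=> X; rewrite (sum_parts X) Dsum big1// => p _.
  exact/hom/homogeneous_part.
elim: k X => [|k IH] X hX; first by rewrite (homogeneous0_fun hX); exact: Df.
apply: form_sectionsP => x j v.
have [a ax] := triv_dom_cover A x.
have [b hb bx] := exists_cutoff (triv_dom_open a) ax.
have := congr1 D (cutoff_euler hb hX).
rewrite Dsum big1 => [|i _]; last first.
  rewrite (DW _ _ _ (mv_section_homogeneous _)) Du form_wedge0l add0r.
  rewrite IH ?form_wedge0r ?scaler0//.
  have := homogeneous_iprod (cutoff_coframe hb i) hX.
  by rewrite -addn1 PoszD addrK.
rewrite DZ (DW 0%N) ?Df ?form_wedge0l ?add0r; last exact: form_fun_homogeneous.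
move=> /(congr1 (fun Y => form_ev (form_at Y x) v)).
rewrite !form_at_Z form_wedge_fun -[LHS]/(0 : R) => /esym/eqP.
rewrite -[Cinf_fun (Cinf_mul b b) x]/(b x * b x).
by rewrite !mulf_eq0 pnatr_eq0 (negPf c0) (negPf bx) /= => /eqP.
Qed.

End Multivectors.

(** * Contraction and the Schouten bracket *)

Lemma signD (R : realType) (a b : int) : (-1) ^ (a + b) = (-1) ^ a * (-1) ^ b :> R.
Proof. by rewrite expfzDr// oppr_eq0 oner_eq0. Qed.

Lemma sign_cases (R : realType) (a : int) : (-1) ^ a = 1 :> R \/ (-1) ^ a = -1 :> R.
Proof.
by case: a => m; rewrite /exprz -signr_odd; case: (odd _);
  rewrite ?expr0 ?expr1 ?invrN ?invr1; [right|left|right|left].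
Qed.

Lemma sign_shift_even (R : realType) (a b c : int) : a = b + c + c ->
  (-1) ^ a = (-1) ^ b :> R.
Proof.
by move=> ->; rewrite !signD; have [->|->] := sign_cases R c;
  rewrite ?mulrN1 ?mulr1 ?opprK.
Qed.

Lemma sign_sqr (R : realType) (a : int) : (-1) ^ a * (-1) ^ a = 1 :> R.
Proof. by have [->|->] := sign_cases R a; rewrite ?mulrNN mulr1. Qed.

Lemma signN (R : realType) (a : int) : - (-1) ^ a = (-1) ^ (a + 1) :> R.
Proof. by rewrite signD expr1z mulrN1. Qed.

(** Identities between linear combinations are checked on the values of a
separating family of linear functionals. The module is abstract here because
unification unfolds the additions of a concrete module of sections. *)
Section SeparatedModule.
Context (R : comNzRingType) (V : lmodType R) (I : Type) (ev : I -> V -> R).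
Hypothesis evP : forall i (c : R) u v, ev i (c *: u + v) = c * ev i u + ev i v.
Hypothesis ev_inj : forall u v, (forall i, ev i u = ev i v) -> u = v.

Let ev0 i : ev i 0 = 0.
Proof. by have := evP i (-1) 0 0; rewrite scaler0 addr0 mulN1r addNr. Qed.
Let evZ i c u : ev i (c *: u) = c * ev i u.
Proof. by rewrite -[c *: u]addr0 evP ev0 addr0. Qed.
Let evD i u v : ev i (u + v) = ev i u + ev i v.
Proof. by rewrite -[u]scale1r evP scale1r mul1r. Qed.

Lemma comb3_shuffle (c s t : R) (a a' b b' d d' : V) :
  (c *: a + a') + (s *: (c *: b + b') + t *: (c *: d + d')) =
  c *: (a + (s *: b + t *: d)) + (a' + (s *: b' + t *: d')).
Proof. by apply: ev_inj => i; rewrite !(evD, evZ); ring. Qed.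

(** The cancellation behind the fact that the defect is a derivation: p, q and t
stand for the signs of the degree of X, of the degree of Y and of their product. *)
Lemma comb_leibniz (p q t : R) (a b c d e f g h : V) : p * p = 1 -> q * q = 1 ->
  (a + - (p * q) *: b + (t * q) *: (c + q *: d)) +
    ((-1) *: (e + t *: f) +
     p *: ((g + - (t * p * q) *: c) + q *: (b + (t * q) *: h))) =
  (a + ((-1) *: e + p *: g)) + t *: (d + ((-1) *: f + p *: h)).
Proof.
move=> pp qq; apply: ev_inj => i; rewrite !(evD, evZ).
transitivity (ev i a - ev i e + p * ev i g + t * (q * q) * ev i d - t * ev i f
  + t * p * (q * q) * ev i h + (1 - p * p) * t * q * ev i c); first by ring.
by rewrite pp qq; ring.
Qed.

(** The same for the symmetry of the defect. *)
Lemma comb_antisym (p q t : R) (a b c : V) : p * p = 1 -> q * q = 1 ->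
  (t * p * q) *: a + ((-1) *: (- (t * p) *: b) + p *: (- (t * q) *: c)) =
  (t * p * q) *: (a + ((-1) *: c + q *: b)).
Proof.
move=> pp qq; apply: ev_inj => i; rewrite !(evD, evZ).
transitivity (t * p * q * ev i a + t * p * (q * q) * ev i b - t * p * q * ev i c).
  by rewrite qq; ring.
by ring.
Qed.

End SeparatedModule.

Section FormValues.
Context (R : realType) (n : nat) (M : manifold R n) (r : nat).
Context (E : vector_bundle M r).

Definition form_value (i : {x : M & {k : nat & 'I_k -> E x}})
    (w : form_sections E) : R :=
  form_ev (form_at w (tag i)) (tagged (tagged i)).

Lemma form_valueP i c (w w' : form_sections E) :
  form_value i (c *: w + w') = c * form_value i w + form_value i w'.
Proof. by []. Qed.

Lemma form_value_inj (w w' : form_sections E) :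
  (forall i, form_value i w = form_value i w') -> w = w'.
Proof.
move=> ww'; apply: form_sectionsP => x k v.
exact: (ww' (Tagged _ (Tagged (fun k => 'I_k -> E x) v))).
Qed.

End FormValues.

Section SchoutenCalculus.
Context (R : realType) (n : nat) (M : manifold R n) (r : nat).
Context (A : vector_bundle M r) (L : lie_algebroid A) (S : schouten_bracket L).
Implicit Types (X Y Z : multivectors A).

Lemma schouten0l Y : S 0 Y = 0.
Proof. exact: (comb0 (fun a X X' => schouten_linearl S a X X' Y)). Qed.

Lemma schouten0r Y : S Y 0 = 0.
Proof. exact: (comb0 (fun a X X' => schouten_linearr S a X X' Y)). Qed.

Lemma schoutenDr X Y Z : S X (Y + Z) = S X Y + S X Z.
Proof. by rewrite -[Y]scale1r schouten_linearr !scale1r. Qed.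

Lemma schoutenZr c X Y : S X (c *: Y) = c *: S X Y.
Proof. by rewrite -[c *: Y]addr0 schouten_linearr schouten0r addr0. Qed.

Lemma schouten_degreez (d e : int) X Y : homogeneous d X -> homogeneous e Y ->
  homogeneous (d + e - 1) (S X Y).
Proof.
move=> hX hY; have [[p dp]|->] := homogeneous_cases hX; last first.
  by rewrite schouten0l; exact: homogeneous0.
have [[q eq]|->] := homogeneous_cases hY; last first.
  by rewrite schouten0r; exact: homogeneous0.
by rewrite dp eq in hX hY *; exact: schouten_degree.
Qed.

Lemma schouten_antisymz (d e : int) X Y : homogeneous d X -> homogeneous e Y ->
  S X Y = (-1) ^ (d * e + d + e) *: S Y X.
Proof.
move=> hX hY; have [[p dp]|->] := homogeneous_cases hX; last first.
  by rewrite schouten0l schouten0r scaler0.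
have [[q eq]|->] := homogeneous_cases hY; last first.
  by rewrite schouten0l schouten0r scaler0.
rewrite dp eq in hX hY *; rewrite (schouten_antisym S hX hY).
congr (_ *: _).
rewrite signN.
by apply: (@sign_shift_even _ _ _ (1 - p%:Z - q%:Z)); ring.
Qed.

Lemma schouten_leibnizz (d e : int) X Y Z : homogeneous d X -> homogeneous e Y ->
  S X (form_wedge Y Z) =
    form_wedge (S X Y) Z + (-1) ^ (d * e + e) *: form_wedge Y (S X Z).
Proof.
move=> hX hY; have [[p dp]|->] := homogeneous_cases hX; last first.
  by rewrite !schouten0l form_wedge0l form_wedge0r scaler0 addr0.
have [[q eq]|->] := homogeneous_cases hY; last first.
  by rewrite !form_wedge0l !schouten0r form_wedge0l scaler0 addr0.
rewrite dp eq in hX hY *; rewrite (schouten_leibniz S Z hX hY).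
have -> // : (-1) ^ ((p%:Z - 1) * q%:Z) = (-1) ^ (p%:Z * q%:Z + q%:Z) :> R.
by apply: (@sign_shift_even _ _ _ (- q%:Z)); ring.
Qed.

Section Defect.
Variable theta : sections (dual_bundle A).
Local Notation iota := (form_iprod theta).

(** For X of degree d, the failure of contraction with theta, of degree -1, to be a
graded derivation of the bracket. *)
Definition defect (d : int) X Y : multivectors A :=
  iota (S X Y) + ((-1) *: S (iota X) Y + (-1) ^ d *: S X (iota Y)).

Lemma defectP d X (c : R) Y Z :
  defect d X (c *: Y + Z) = c *: defect d X Y + defect d X Z.
Proof.
rewrite /defect form_iprodP !schouten_linearr form_iprodP.
exact: (comb3_shuffle (@form_valueP _ _ _ _ _) (@form_value_inj _ _ _ _ _)).
Qed.

(** The defect is the graded commutator of the derivations iota and S X, minus the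
derivation S (iota X). *)
Lemma defect_leibniz (d e : int) X Y Z : homogeneous d X -> homogeneous e Y ->
  defect d X (form_wedge Y Z) =
  form_wedge (defect d X Y) Z + (-1) ^ (d * e) *: form_wedge Y (defect d X Z).
Proof.
move=> hX hY; rewrite /defect.
rewrite (schouten_leibnizz Z hX hY) form_iprodD form_iprodZ.
rewrite (form_iprod_wedge _ _ (schouten_degreez hX hY)).
rewrite !(form_iprod_wedge _ _ hY).
rewrite (schouten_leibnizz Z (homogeneous_iprod theta hX) hY).
rewrite schoutenDr schoutenZr.
rewrite (schouten_leibnizz Z hX (homogeneous_iprod theta hY)).
rewrite (schouten_leibnizz (iota Z) hX hY).
rewrite !form_wedgeDl !form_wedgeDr !form_wedgeZl !form_wedgeZr.
have -> : (-1) ^ (d + e - 1) = - ((-1) ^ d * (-1) ^ e) :> R.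
  by rewrite -signD signN; apply: (@sign_shift_even _ _ _ (-1)); ring.
have -> : (-1) ^ ((d - 1) * e + e) = (-1) ^ (d * e) :> R by congr (_ ^ _); ring.
have -> : (-1) ^ (d * (e - 1) + (e - 1)) =
    - ((-1) ^ (d * e) * (-1) ^ d * (-1) ^ e) :> R.
  rewrite -!signD signN.
  by apply: (@sign_shift_even _ _ _ (- d - 1)); ring.
rewrite [(-1) ^ (d * e + e)]signD.
exact: (comb_leibniz (@form_valueP _ _ _ _ _) (@form_value_inj _ _ _ _ _)
  _ _ _ _ _ _ _ _ _ (sign_sqr R d) (sign_sqr R e)).
Qed.

Lemma defect_antisym (d e : int) X Y : homogeneous d X -> homogeneous e Y ->
  defect d X Y = (-1) ^ (d * e + d + e) *: defect e Y X.
Proof.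
move=> hX hY; rewrite /defect (schouten_antisymz hX hY) form_iprodZ.
rewrite (schouten_antisymz (homogeneous_iprod theta hX) hY).
rewrite (schouten_antisymz hX (homogeneous_iprod theta hY)).
have -> : (-1) ^ ((d - 1) * e + (d - 1) + e) = - ((-1) ^ (d * e) * (-1) ^ d) :> R.
  by rewrite -!signD signN; apply: (@sign_shift_even _ _ _ (-1)); ring.
have -> : (-1) ^ (d * (e - 1) + d + (e - 1)) = - ((-1) ^ (d * e) * (-1) ^ e) :> R.
  by rewrite -!signD signN; apply: (@sign_shift_even _ _ _ (-1)); ring.
rewrite !signD.
exact: (comb_antisym (@form_valueP _ _ _ _ _) (@form_value_inj _ _ _ _ _)
  _ _ _ _ (sign_sqr R d) (sign_sqr R e)).
Qed.

Lemma iota_homogeneous0 X : homogeneous 0 X -> iota X = 0.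
Proof. by move=> /(homogeneous_iprod theta) h; apply: homogeneous_lt0 h. Qed.

Lemma iota_fun f : iota (mv_fun A f) = 0.
Proof. exact/iota_homogeneous0/form_fun_homogeneous. Qed.

Definition pairing (u : sections A) : Cinf M :=
  form_eval (mv_section u) (fun _ : 'I_1 => theta).

Lemma pairingE u x :
  pairing u x = (section_at theta x : 'Hom(A x, R^o)) (section_at u x).
Proof. by []. Qed.

Lemma iota_section u : iota (mv_section u) = mv_fun A (pairing u).
Proof.
apply: form_sectionsP => x [|k] v; last by [].
by rewrite form_iprod_ev mv_sectionE insert_at.
Qed.

Hypothesis closed : forall u v : sections A,
  pairing (bracket L u v) = anchor_act L u (pairing v) - anchor_act L v (pairing u).

(** On functions and sections all terms vanish for reasons of degree. *)
Lemma defect_fun f Y : defect 0 (mv_fun A f) Y = 0.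
Proof.
have hf : homogeneous 0 (mv_fun A f) :=
  @form_fun_homogeneous _ _ _ _ (dual_bundle A) f.
pose c (q : nat) : R := 1.
apply: (@derivation_eq0 _ _ _ _ _ (defect 0 (mv_fun A f)) c _ _ _ _ _ Y).
- exact: defectP.
- exact: oner_neq0.
- by move=> q Y' Z hY'; rewrite (defect_leibniz _ hf hY') mul0r expr0z.
- move=> g; rewrite /defect !iota_fun schouten0l schouten0r !scaler0 !addr0.
  have hg := @form_fun_homogeneous _ _ _ _ (dual_bundle A) g.
  by rewrite (homogeneous_lt0 _ (schouten_degreez hf hg)) ?form_iprod0.
- move=> u; have hu := @mv_section_homogeneous _ _ _ _ A u.
  rewrite /defect iota_fun schouten0l scaler0 add0r.
  have := schouten_degreez hf hu => /iota_homogeneous0 ->; rewrite add0r.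
  rewrite iota_section.
  have hg := @form_fun_homogeneous _ _ _ _ (dual_bundle A) (pairing u).
  by rewrite (homogeneous_lt0 _ (schouten_degreez hf hg)) ?scaler0.
Qed.

(** The value is the function d theta (u, v), up to sign. *)
Lemma defect_section_section u v : defect 1 (mv_section u) (mv_section v) = 0.
Proof.
rewrite /defect schouten_section !iota_section schouten_fun.
have hg := @form_fun_homogeneous _ _ _ _ (dual_bundle A) (pairing u).
rewrite (schouten_antisymz hg (@mv_section_homogeneous _ _ _ _ A v)) schouten_fun.
rewrite closed mul0r !add0r expr1z.
by rewrite mv_funB !scaleN1r opprK addrA subrK subrr.
Qed.

Lemma defect_section u Y : defect 1 (mv_section u) Y = 0.
Proof.
have hu := @mv_section_homogeneous _ _ _ _ A u.
pose c (q : nat) : R := (-1) ^ (1 * q%:Z).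
apply: (@derivation_eq0 _ _ _ _ _ (defect 1 (mv_section u)) c _ _ _ _ _ Y).
- exact: defectP.
- by rewrite /c mulr0 expr0z oner_neq0.
- by move=> q Y' Z hY'; rewrite (defect_leibniz _ hu hY').
- move=> f; have hf : homogeneous 0 (mv_fun A f) :=
    @form_fun_homogeneous _ _ _ _ (dual_bundle A) f.
  by rewrite (defect_antisym hu hf) defect_fun scaler0.
- exact: defect_section_section.
Qed.

Lemma defect_eq0 (p : nat) X Y : homogeneous p%:Z X -> defect p%:Z X Y = 0.
Proof.
move=> hX; pose c (q : nat) : R := (-1) ^ (p%:Z * q%:Z).
apply: (@derivation_eq0 _ _ _ _ _ (defect p%:Z X) c _ _ _ _ _ Y).
- exact: defectP.
- by rewrite /c mulr0 expr0z oner_neq0.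
- by move=> q Y' Z hY'; rewrite (defect_leibniz _ hX hY').
- move=> f; have hf : homogeneous 0 (mv_fun A f) :=
    @form_fun_homogeneous _ _ _ _ (dual_bundle A) f.
  by rewrite (defect_antisym hX hf) defect_fun scaler0.
- move=> u; have hu := @mv_section_homogeneous _ _ _ _ A u.
  by rewrite (defect_antisym hX hu) defect_section scaler0.
Qed.

Lemma iota_is_differential : is_differential S 0 iota.
Proof.
split=> [c X Y|p X hX|p X Y hX|p X Y hX].
- exact: form_iprodP.
- by rewrite addr0; exact: homogeneous_iprod.
- have -> : (-1) ^ ((0%:Z - 1) * p%:Z) = (-1) ^ p%:Z :> R.
    by apply: (@sign_shift_even _ _ _ (- p%:Z)); ring.
  exact: form_iprod_wedge.
- have /eqP := defect_eq0 Y hX; rewrite /defect addr_eq0 => /eqP ->.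
  rewrite opprD -scaleNr opprK scale1r; congr (_ + _); rewrite -scaleNr.
  congr (_ *: _); rewrite signN.
  by apply: (@sign_shift_even _ _ _ p%:Z); ring.
Qed.

End Defect.

(** Both sides are derivations of the wedge product that kill functions. *)
Lemma differential_eq_schouten d (tau : multivectors A) :
  is_differential S 0 d -> homogeneous 0%:Z tau ->
  (forall u : sections A, d (mv_section u) = S tau (mv_section u)) ->
  forall X, d X = S tau X.
Proof.
move=> [dl dd dw _] ht dt X; apply/eqP; rewrite -subr_eq0 -scaleN1r; apply/eqP.
pose c (q : nat) : R := (-1) ^ q%:Z.
apply: (@derivation_eq0 _ _ _ _ _ (fun X => d X + (-1) *: S tau X) c _ _ _ _ _ X).
- by move=> s Y Z; rewrite dl schouten_linearr comb_shuffle.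
- by rewrite /c expr0z oner_neq0.
- move=> q Y Z hY; rewrite (dw _ _ _ hY) (schouten_leibnizz _ ht hY).
  have -> : (-1) ^ ((0%:Z - 1) * q%:Z) = c q.
    by apply: (@sign_shift_even _ _ _ (- q%:Z)); ring.
  rewrite mul0r add0r -/(c q) !form_wedgeDl !form_wedgeDr form_wedgeZl form_wedgeZr.
  by rewrite !scalerDr !scalerA [c q * _]mulrC addrACA.
- move=> f; have hf : homogeneous 0 (mv_fun A f) :=
    @form_fun_homogeneous _ _ _ _ (dual_bundle A) f.
  have h1 := dd _ _ hf; rewrite (homogeneous_lt0 _ h1)//.
  by rewrite (homogeneous_lt0 _ (schouten_degreez ht hf))// scaler0 addr0.
- by move=> u; rewrite dt scaleN1r subrr.
Qed.

End SchoutenCalculus.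

(** * Isomorphisms of quotients *)

Section QuotientIsomorphism.
Context (R : realType) (V V' : lmodType R) (W : subspace V) (W' : subspace V').

Lemma quotient_iso (F : V -> V') :
  (forall (c : R) u v, F (c *: u + v) = c *: F u + F v) ->
  (forall v', exists v, F v = v') ->
  (forall v, W v <-> W' (F v)) ->
  exists Phi : {linear quot_of W -> quot_of W'}, bijective Phi.
Proof.
move=> Fl Fsurj FW.
have FB u v : F (u - v) = F u - F v.
  by rewrite -[- v]scaleN1r addrC Fl scaleN1r addrC.
pose phi (q : quot_of W) : quot_of W' := quot_proj W' (F (quot_repr q)).
have phiE v : phi (quot_proj W v) = quot_proj W' (F v).
  by apply/quot_projP; rewrite -FB; apply/FW; exact: repr_quot_proj.
have phil : linear phi.
  move=> c p q; rewrite -[p]quot_projK -[q]quot_projK.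
  rewrite [_ *: quot_proj W _]quot_scaleE [quot_proj W _ + _]quot_addE !phiE.
  by rewrite [_ *: quot_proj W' _]quot_scaleE [quot_proj W' _ + _]quot_addE Fl.
pose Phi : {linear quot_of W -> quot_of W'} :=
  HB.pack phi (GRing.isLinear.Build _ _ _ _ phi phil).
exists Phi; have inj : injective phi.
  move=> p q; rewrite -[p]quot_projK -[q]quot_projK !phiE => /quot_projP.
  by rewrite -FB => /FW ?; apply/quot_projP.
have surj q : exists p, phi p = q.
  have [v Fv] := Fsurj (quot_repr q).
  by exists (quot_proj W v); rewrite phiE Fv quot_projK.
have [g gK] := choice surj.
by exists g => // p; apply: inj; rewrite gK.
Qed.

End QuotientIsomorphism.

(** * One-forms from maps linear over the functions *)

Section Tensoriality.
Context (R : realType) (n : nat) (M : manifold R n) (r : nat).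
Context (A : vector_bundle M r).

Lemma CinfD (f g : Cinf M) x : Cinf_fun (f + g) x = f x + g x.
Proof. by []. Qed.

Lemma exists_section_through x (v : A x) : exists s : sections A, section_at s x = v.
Proof.
have [a ax] := triv_dom_cover A x.
have [b hb bx] := exists_cutoff (triv_dom_open a) ax.
exists (\sum_i ((b x)^-1 * triv a x v 0 i) *: cutoff_frame hb i).
rewrite sections_sum [RHS](frame_expand v ax); apply: eq_bigr => i _.
rewrite -[LHS]/(_ *: (b x *: frame a x i)) scalerA; congr (_ *: _).
by rewrite mulrAC mulVf// mul1r.
Qed.

(** The expansion of b^2 u in a cut-off frame shows that h u x depends only on u x,
through the coefficients h (e_i) x / b x; smoothness is seen by evaluating on e_j
and dividing by b. *)
Lemma tensorial_pairing (h : sections A -> Cinf M) :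
  (forall (c : R) u v, h (c *: u + v) = c *: h u + h v) ->
  (forall f u, h (section_mul f u) = Cinf_mul f (h u)) ->
  exists theta : sections (dual_bundle A), forall u, pairing theta u = h u.
Proof.
move=> hl hM.
have h0 : h 0 = 0 by exact: comb0.
have hsum (I : finType) (F : I -> sections A) x :
    h (\sum_i F i) x = \sum_i h (F i) x.
  elim: (index_enum I) => [|i s IH]; first by rewrite !big_nil h0.
  by rewrite !big_cons -[F i]scale1r hl !scale1r CinfD IH.
(* For each point, a trivialization and the coordinates of the covector there. *)
have loc x : exists ac : triv_ix A * 'rV[R]_r,
    forall u, h u x = dual_comb ac.1 ac.2 (section_at u x).
  have [a ax] := triv_dom_cover A x.
  have [b hb bx] := exists_cutoff (triv_dom_open a) ax.
  exists (a, \row_i ((b x)^-1 * h (cutoff_frame hb i) x)) => u /=.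
  have := congr1 (fun f => Cinf_fun f x) (congr1 h (cutoff_section_expand hb u)).
  rewrite hM hsum -[LHS]/(b x * b x * h u x) => E.
  apply: (mulfI (_ : b x * b x != 0)); first by rewrite mulf_neq0.
  rewrite E /dual_comb mulr_sumr; apply: eq_bigr => i _.
  rewrite hM -[LHS]/(b x * triv a x (section_at u x) 0 i * h _ x) mxE.
  by field.
have [ac acP] := choice loc.
pose t (x : M) : dual_fiber A x := linfun (@dual_comb _ _ _ _ A (ac x).1 x (ac x).2).
have tE x u : (t x : 'Hom(A x, R^o)) (section_at u x) = h u x.
  by rewrite lfunE /= acP.
have st : is_smooth_section (E := dual_bundle A) t.
  move=> a' j; pose a0 : triv_ix A := a'.
  apply: smooth_fun_local => x ax'; have {ax'}ax : triv_dom a0 x := ax'.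
  have [b hb bx] := exists_cutoff (triv_dom_open a0) ax.
  have cb : continuous (b : M -> R^o).
    by move=> y; apply: (smooth_fun_continuous openT (sub_ofP b)).
  pose U := triv_dom a0 `&` [set y | b y != 0].
  have oU : open U.
    apply: openI; first exact: triv_dom_open.
    apply: (open_comp (f := b : M -> R^o) (D := [set y | y != 0])) => [y _|].
      exact: cb.
    exact: open_neq.
  exists U; first by split.
  have tbE y : U y -> (b y)^-1 * h (cutoff_frame hb j) y = dual_triv a0 y (t y) 0 j.
    move=> [ay /= by0]; rewrite [in RHS]lfunE mxE -tE cutoff_frameE linearZ.
    rewrite -[LHS]/((b y)^-1 * (b y * (t y : 'Hom(A y, R^o)) (frame a0 y j))).
    by rewrite mulKf.
  suff : smooth_fun_on U (fun y => (b y)^-1 * h (cutoff_frame hb j) y).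
    exact: smooth_fun_ext oU tbE.
  apply: smooth_funM => //.
    apply: smooth_fun_inv => //; first by move=> y [].
    exact: smooth_fun_sub (sub_ofP b).
  exact: smooth_fun_sub (sub_ofP (h _)).
exists (mk_sub (W := section_subspace (dual_bundle A)) st) => u.
by apply: CinfP => x; rewrite pairingE tE.
Qed.

End Tensoriality.

(** * Cocycles and coboundaries of degree one *)

Section OneCocycles.
Context (R : realType) (n : nat) (M : manifold R n) (r : nat).
Context (A : vector_bundle M r) (L : lie_algebroid A).
Implicit Types (w : form_sections A) (u v : sections A).

Lemma form_of_dual_smooth (theta : sections (dual_bundle A)) : is_smooth_form (E := A)
  (fun x => form1 (section_at theta x : 'Hom(A x, R^o))).
Proof.
move=> a [|[|k]] I; try exact: smooth_fun_cst.
apply: smooth_fun_ext (sub_ofP theta a (I ord0)); first exact: triv_dom_open.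
by move=> x ax; rewrite -[LHS]/(dual_triv a x (val theta x) 0 (I ord0)) lfunE mxE.
Qed.

Definition form_of_dual (theta : sections (dual_bundle A)) : form_sections A :=
  mk_sub (W := form_subspace A) (form_of_dual_smooth theta).

Lemma form_of_dual_homogeneous theta : homogeneous 1%:Z (form_of_dual theta).
Proof. by move=> [|[|k]] x v. Qed.

Definition on_section w u : Cinf M := form_eval w (fun _ : 'I_1 => u).

Lemma on_section_dual theta u : on_section (form_of_dual theta) u = pairing theta u.
Proof. exact: CinfP. Qed.

Lemma on_sectionP c w w' u :
  on_section (c *: w + w') u = c *: on_section w u + on_section w' u.
Proof. exact: form_evalP. Qed.

Lemma on_section_linear w (c : R) u v :
  on_section w (c *: u + v) = c *: on_section w u + on_section w v.
Proof.
apply: CinfP => x.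
have H := form_ev_lin (form_at w x) ord0 (fun _ : 'I_1 => 0 : A x) c
  (section_at u x) (section_at v x).
have E z : dfwith (fun _ : 'I_1 => 0 : A x) ord0 z = (fun _ => z).
  by apply/funext => i; rewrite (ord1 i) dfwithin.
by rewrite !E in H.
Qed.

Lemma on_section_mul w f u : on_section w (section_mul f u) = Cinf_mul f (on_section w u).
Proof.
apply: CinfP => x.
have H := form_ev_lin (form_at w x) ord0 (fun _ : 'I_1 => 0 : A x) (f x)
  (section_at u x) 0.
have H0 := form_ev_lin (form_at w x) ord0 (fun _ : 'I_1 => 0 : A x) (-1) 0 0.
have E z : dfwith (fun _ : 'I_1 => 0 : A x) ord0 z = (fun _ => z).
  by apply/funext => i; rewrite (ord1 i) dfwithin.
rewrite !E scaler0 addr0 mulN1r addNr in H0.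
by rewrite !E H0 !addr0 in H.
Qed.

Lemma on_section_inj w w' : homogeneous 1%:Z w -> homogeneous 1%:Z w' ->
  (forall u, on_section w u = on_section w' u) -> w = w'.
Proof.
move=> hw hw' E; apply: form_sectionsP => x k v.
have [k1|k1] := eqVneq k 1%N; last by rewrite hw ?hw'.
move: v; rewrite k1 => v; have [s sv] := exists_section_through (v ord0).
have -> : v = (fun _ => section_at s x).
  by apply/funext => i; rewrite (ord1 i) sv.
exact: (congr1 (fun f => Cinf_fun f x) (E s)).
Qed.

Lemma form_eval_homogeneous (p k : nat) w (u : 'I_k -> sections A) :
  homogeneous p%:Z w -> k != p -> form_eval w u = 0.
Proof. by move=> hw kp; apply: CinfP => x; rewrite [LHS]hw. Qed.

Lemma anchor_act0 u : anchor_act L u 0 = 0.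
Proof. exact: (comb0 (fun c f g => anchor_actP L c u f g)). Qed.

Lemma anchor_actN u f : anchor_act L u (- f) = - anchor_act L u f.
Proof. by rewrite -scaleN1r -[-1 *: f]addr0 anchor_actP anchor_act0 addr0 scaleN1r. Qed.

Lemma ce_value_homogeneous (p k : nat) w (u : 'I_k.+1 -> sections A) :
  homogeneous p%:Z w -> k != p -> ce_value L w u = 0.
Proof.
move=> hw kp; have z := form_eval_homogeneous _ hw kp; rewrite /ce_value.
have -> : \sum_(i < k.+1) \sum_(j < k.+1 | (i < j)%N) (-1) ^+ j *:
    form_eval w (fun m : 'I_k => dfwith u i (bracket L (u i) (u j)) (lift j m)) = 0.
  by rewrite big1// => i _; rewrite big1// => j _; rewrite z scaler0.
by rewrite addr0 big1// => i _; rewrite z anchor_act0 scaler0.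
Qed.

Lemma ce_value1 w (u : 'I_2 -> sections A) : ce_value L w u =
  anchor_act L (u ord0) (on_section w (u ord_max)) -
  anchor_act L (u ord_max) (on_section w (u ord0)) -
  on_section w (bracket L (u ord0) (u ord_max)).
Proof.
have lift0 : lift ord0 ord0 = ord_max :> 'I_2 by apply: val_inj.
have liftm : lift ord_max ord0 = ord0 :> 'I_2 by apply: val_inj.
have ev v (z : 'I_1 -> sections A) : z ord0 = v -> form_eval w z = on_section w v.
  by move=> <-; congr form_eval; apply/funext => i; rewrite (ord1 i).
rewrite /ce_value; congr (_ + _).
  rewrite big_ord_recr big_ord1 /=.
  rewrite (ev (u ord_max)) ?(ev (u ord0)) ?liftm//.
    rewrite expr0 expr1 scale1r scaleN1r.
    by congr (anchor_act L (u _) _ - _); apply: val_inj.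
  by rewrite -lift0; congr (u (lift _ _)); apply: val_inj.
rewrite big_ord_recr big_ord1 /= [X in _ + X]big_pred0 ?addr0; last first.
  by case=> -[|[|j]].
rewrite (big_pred1 ord_max); last by case=> -[|[|j]].
rewrite expr1 scaleN1r.
congr (- _); apply: ev; rewrite liftm.
have -> : widen_ord (leqnSn 1) ord0 = ord0 :> 'I_2 by apply: val_inj.
by rewrite dfwithin.
Qed.

Lemma cocycle1P w : homogeneous 1%:Z w ->
  is_ce_differential L w 0 <-> forall u v, on_section w (bracket L u v) =
    anchor_act L u (on_section w v) - anchor_act L v (on_section w u).
Proof.
move=> hw; split=> [[_ dw] u v|dw].
  have := dw 1%N (fun i : 'I_2 => if i == ord0 then u else v).
  rewrite ce_value1 /= => /esym/eqP.
  have -> : form_eval (0 : form_sections A)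
      (fun i : 'I_2 => if i == ord0 then u else v) = 0 by exact: CinfP.
  by rewrite subr_eq0 => /eqP.
split=> [u|k u]; first exact: CinfP.
have -> : form_eval (0 : form_sections A) u = 0 by exact: CinfP.
have [k1|k1] := eqVneq k 1%N; last by rewrite (ce_value_homogeneous _ hw k1).
by move: u; rewrite k1 => u; rewrite ce_value1 dw subrr.
Qed.

Lemma coboundary1P w (f : Cinf M) : homogeneous 1%:Z w ->
  is_ce_differential L (form_fun A f) w <->
  forall u, on_section w u = anchor_act L u f.
Proof.
move=> hw; have hf := @form_fun_homogeneous _ _ _ _ A f.
have ce0 (u : 'I_1 -> sections A) :
    ce_value L (form_fun A f) u = anchor_act L (u ord0) f.
  rewrite /ce_value !big_ord_recl !big_ord0 /= !addr0 big_pred0; last by case=> -[].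
  rewrite expr0 scale1r addr0; congr anchor_act; exact: CinfP.
split=> [[_ df] u|dw]; first by rewrite /on_section df ce0.
split=> [u|k u]; first by rewrite (form_eval_homogeneous _ hw).
have [k0|k0] := eqVneq k 0%N; last first.
  by rewrite (ce_value_homogeneous _ hf k0) (form_eval_homogeneous _ hw).
move: u; rewrite k0 => u; rewrite ce0 -dw; congr form_eval.
by apply/funext => i; rewrite (ord1 i).
Qed.

End OneCocycles.

(** * The 1-form of a 0-differential *)

Section DifferentialsAndCocycles.
Context (R : realType) (n : nat) (M : manifold R n) (r : nat).
Context (A : vector_bundle M r) (L : lie_algebroid A) (S : schouten_bracket L).

Lemma schouten_fun_section (f : Cinf M) (u : sections A) :
  S (mv_fun A f) (mv_section u) = - mv_fun A (anchor_act L u f).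
Proof.
have hf : homogeneous 0 (mv_fun A f) :=
  @form_fun_homogeneous _ _ _ _ (dual_bundle A) f.
rewrite (schouten_antisymz S hf (@mv_section_homogeneous _ _ _ _ A u)).
by rewrite schouten_fun mul0r !add0r expr1z scaleN1r.
Qed.

Lemma mv_fun_inj : injective (mv_fun A).
Proof.
move=> f g fg; apply: CinfP => x.
exact: (congr1 (fun X => form_ev (form_at X x) (fun i : 'I_0 => 0)) fg).
Qed.

Definition represents (d : differential S 0) (w : form_sections A) : Prop :=
  homogeneous 1%:Z w /\
  forall u, val d (mv_section u) = mv_fun A (on_section w u).

Lemma represents_inj d w w' : represents d w -> represents d w' -> w = w'.
Proof.
move=> [hw dw] [hw' dw']; apply: on_section_inj => // u.
by apply: mv_fun_inj; rewrite -dw.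
Qed.

Lemma exists_represents d : exists w, represents d w.
Proof.
have [dl dd dw _] := sub_ofP d.
pose h u : Cinf M := form_eval (val d (mv_section u)) (fun i : 'I_0 => 0).
have hE u : val d (mv_section u) = mv_fun A (h u).
  have := dd _ _ (@mv_section_homogeneous _ _ _ _ A u) => /homogeneous0_fun.
  exact.
have [|f u|theta th] := @tensorial_pairing _ _ _ _ A h.
- by move=> c u v; apply: mv_fun_inj; rewrite -hE mv_section_linear dl !hE mv_funP.
- apply: mv_fun_inj; rewrite -hE mv_section_mul.
  have hf := @form_fun_homogeneous _ _ _ _ (dual_bundle A) f.
  rewrite (dw 0%N _ _ hf) mulr0 expr0z scale1r hE.
  rewrite (homogeneous_lt0 _ (dd _ _ hf))// form_wedge0l add0r.
  apply: form_sectionsP => x [|k] v; rewrite form_wedge_fun; first by [].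
  by rewrite !(form_fun_homogeneous (E := dual_bundle A) _ (k := k.+1))// mulr0.
exists (form_of_dual theta); split; first exact: form_of_dual_homogeneous.
by move=> u; rewrite hE on_section_dual th.
Qed.

(** The compatibility with the bracket of two sections, read on functions. *)
Lemma represents_cocycle d w : represents d w -> is_cocycle L 1 w.
Proof.
move=> [hw dE]; split=> //; apply/(cocycle1P L hw) => u v.
have [_ _ _ ds] := sub_ofP d.
have := ds _ _ (mv_section v) (@mv_section_homogeneous _ _ _ _ A u).
rewrite schouten_section !dE schouten_fun_section schouten_fun.
rewrite subrr mulr0 expr0z scale1r.
by rewrite addrC -mv_funB => /mv_fun_inj.
Qed.

Lemma cocycle_represented (w : cocycle L 1) : exists d, represents d (val w).
Proof.
have [hw dw] := sub_ofP w.
have [theta th] :=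
  tensorial_pairing (on_section_linear (val w)) (on_section_mul (val w)).
have closed u v : pairing theta (bracket L u v) =
    anchor_act L u (pairing theta v) - anchor_act L v (pairing theta u).
  by rewrite !th; apply: (cocycle1P L hw).1.
exists (mk_sub (W := differential_subspace S 0) (iota_is_differential S closed)).
by split=> // u; rewrite -th -iota_section.
Qed.

(** The sign in [f, u] = - rho(u) f makes bracketing with f correspond to the
coboundary of - f. *)
Lemma exact_coboundary (d : differential S 0) (w : cocycle L 1) :
  represents d (val w) -> is_exact_differential d <-> is_coboundary w.
Proof.
move=> [hw dE]; split=> [[tau ht dt]|[eta]].
  rewrite (homogeneous0_fun ht) in dt; move: (form_eval _ _) dt => f dt.
  exists (form_fun A (- f)).
    by rewrite subrr; exact: form_fun_homogeneous.
  apply/(coboundary1P L _ hw) => u; apply: mv_fun_inj; rewrite -dE dt.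
  by rewrite -[form_fun _ f]/(mv_fun A f) schouten_fun_section anchor_actN mv_funN.
rewrite subrr => heta; rewrite (homogeneous0_fun heta).
move: (form_eval _ _) => f /(coboundary1P L _ hw) wf.
have hf := @form_fun_homogeneous _ _ _ _ (dual_bundle A) (- f).
exists (mv_fun A (- f)) => //.
apply: (differential_eq_schouten (sub_ofP d) hf) => u.
by rewrite dE wf schouten_fun_section anchor_actN mv_funN opprK.
Qed.

End DifferentialsAndCocycles.

Theorem proposition6p1 (R : realType) (n r : nat) (M : manifold R n)
    (A : vector_bundle M r) (L : lie_algebroid A) (S : schouten_bracket L) :
  exists Phi : {linear reduced_differentials S 0 -> lie_algebroid_cohomology L 1},
    bijective Phi.
Proof.
have ex (d : differential S 0) : exists w : cocycle L 1, represents d (val w).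
  have [w dw] := exists_represents d.
  by exists (mk_sub (W := Subspace (is_cocycle0 L 1) (@is_cocycleP _ _ _ _ _ L 1))
    (represents_cocycle dw)).
have [F FP] := choice ex.
apply: (quotient_iso (F := F)).
- move=> c d d'; apply: val_inj; apply: (represents_inj (FP _)).
  have [h dE] := FP d; have [h' dE'] := FP d'.
  split; first exact: homogeneousP.
  by move=> u; rewrite on_sectionP mv_funP -dE -dE'.
- move=> w; have [d dw] := cocycle_represented S w.
  by exists d; apply: val_inj; apply: represents_inj (FP d) dw.
- by move=> d; exact: exact_coboundary.
Qed.
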